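(* Let $\mathsf{2\text{-}Mnd}$ be the lax-Gray category with one object $*$ freely generated by a 1-cell $T:*\to *$, 2-cells $\eta:1\to T$ and $\mu:T^2\to T$, and 3-cells $a:\mu\cdot T\mu\Rightarrow\mu\cdot\mu T$, $p:\mu\cdot T\eta\Rightarrow 1_T$, $q:1_T\Rightarrow\mu\cdot\eta T$, subject to the five lax-Gray monad coherence equations. Then the lax-Gray 2-monad $(T,\eta,\mu,a,p,q)$ on $*$ in $\mathsf{2\text{-}Mnd}$ is universal for lax-Gray 2-monads on objects of a lax-Gray category. That is, for every lax-Gray category $\mathbb{C}$, every object $X$ of $\mathbb{C}$ and every lax-Gray 2-monad $(T_X,\eta_X,\mu_X,a_X,p_X,q_X)$ on $X$ in $\mathbb{C}$, there exists a unique lax-Gray functor $G:\mathsf{2\text{-}Mnd}\to\mathbb{C}$ with $G( * )=X$ and $(GT,G\eta,G\mu,Ga,Gp,Gq)=(T_X,\eta_X,\mu_X,a_X,p_X,q_X)$.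
   Context: All 2-categories and 2-functors are strict. **Lax-Gray categories.** For 2-categories $C,D$ let $P_L(C,D)$ be the 2-category of 2-functors, lax natural transformations and modifications from $C$ to $D$. A lax natural transformation $\varphi:S\to R$ has 2-cells $\varphi_h:\varphi_B\cdot Sh\Rightarrow Rh\cdot\varphi_A$ for $h:A\to B$. The tensor product $\otimes_L$ on the category $\mathsf{2\text{-}Cat}$ of 2-categories and 2-functors is determined by $\mathsf{2\text{-}Cat}(B\otimes_L C,D)\cong\mathsf{2\text{-}Cat}(B,P_L(C,D))$. A lax-Gray category is a category enriched in $(\mathsf{2\text{-}Cat},\otimes_L)$, and a lax-Gray functor is an enriched functor between such. A lax-Gray category thus has objects, 1-cells, 2-cells and 3-cells, hom 2-categories $\mathbb{C}(X,Y)$, and composition 2-functors $\mathbb{C}(Y,Z)\otimes_L\mathbb{C}(X,Y)\to\mathbb{C}(X,Z)$. Hence 1-cells compose strictly and act on 2- and 3-cells by whiskering (written by juxtaposition). For 2-cells $\alpha:g\to g'$ in $\mathbb{C}(Y,Z)$ and $\beta:h\to h'$ in $\mathbb{C}(X,Y)$ there is an interchange 3-cell $\alpha\beta:\alpha h'\cdot g\beta\Rightarrow g'\beta\cdot\alpha h$, satisfying the equations encoded by $\otimes_L$. Lax-Gray functors strictly preserve all this structure. **Notation.** ''$\cdot$'' is composition of 2-cells in a hom 2-category and whiskering of 3-cells by 2-cells along this composition. ''$..$'' is vertical composition of 3-cells, rightmost factor first. **Lax-Gray 2-monad.** A lax-Gray 2-monad on an object $X$ of a lax-Gray category $\mathbb{C}$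 is a 6-tuple $(T,\eta,\mu,a,p,q)$ with $T:X\to X$ a 1-cell, $\eta:1_X\to T$ and $\mu:T^2\to T$ 2-cells, and $a:\mu\cdot T\mu\Rightarrow\mu\cdot\mu T$, $p:\mu\cdot T\eta\Rightarrow 1_T$, $q:1_T\Rightarrow\mu\cdot\eta T$ 3-cells, satisfying the five coherence equations 1. $(a\cdot\mu T^2)\,..\,(\mu\cdot\mu\mu)\,..\,(a\cdot T^2\mu)=(\mu\cdot aT)\,..\,(a\cdot T\mu T)\,..\,(\mu\cdot Ta)$ 2. $(p\cdot\eta)\,..\,(\mu\cdot\eta\eta)\,..\,(q\cdot\eta)=1_\eta$ 3. $(\mu\cdot pT)\,..\,(a\cdot T\eta T)\,..\,(\mu\cdot Tq)=1_\mu$ 4. $(a\cdot\eta T^2)\,..\,(\mu\cdot\eta\mu)\,..\,(q\cdot\mu)=\mu\cdot qT$ 5. $(p\cdot\mu)\,..\,(\mu\cdot\mu\eta)\,..\,(a\cdot T^2\eta)=\mu\cdot Tp$ where $\mu\mu:\mu T\cdot T^2\mu\Rightarrow T\mu\cdot\mu T^2$, $\eta\eta:\eta T\cdot\eta\Rightarrow T\eta\cdot\eta$, $\eta\mu:\eta T\cdot\mu\Rightarrow T\mu\cdot\eta T^2$ and $\mu\eta:\mu T\cdot T^2\eta\Rightarrow T\eta\cdot\mu$ are interchange 3-cells. **The lax-Gray category $\mathsf{2\text{-}Mnd}$.** It has one object $*$ and 1-cells $1,T,T^2,\dots,T^n,\dots$. Its 2-cells are finite composable strings (including empty ones, the identities)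 of the basic 2-cells $T^i\eta T^{n-i}:T^n\to T^{n+1}$ ($0\le i\le n$) and $T^i\mu T^{n-i-1}:T^{n+1}\to T^n$ ($0\le i\le n-1$). Its 3-cells are generated, under whiskering by 1-cells and 2-cells and vertical composition, by $a,p,q$ and the interchange 3-cells of the 2-cells, modulo only the axioms of a lax-Gray category and the five coherence equations above. *)

(* Defs.v *)
From HB Require Import structures.
From mathcomp Require Import all_boot.
From mathcomp Require Import boolp.

Set Implicit Arguments.
Unset Strict Implicit.
Unset Printing Implicit Defensive.

Declare Scope twocat_scope.
Delimit Scope twocat_scope with tc.
Local Open Scope twocat_scope.

(** Cells of each dimension of a strict 2-category form one type, with source
    and target maps, so that the strict equations of the theory are plain
    equalities, without transport.  The compositions are total functions which
    the axioms constrain only on composable arguments; their values elsewhere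
    are irrelevant, and 2-functors are not asked to preserve them.  [comp1 g f]
    and [hcomp b a] are [g . f] and [b . a], [vcomp b a] is [b .. a]; the
    rightmost argument comes first. *)

Record two_cat := TwoCat {
  cell0 : Type;
  cell1 : Type;
  cell2 : Type;
  src1 : cell1 -> cell0;
  tgt1 : cell1 -> cell0;
  src2 : cell2 -> cell1;
  tgt2 : cell2 -> cell1;
  id1 : cell0 -> cell1;
  comp1 : cell1 -> cell1 -> cell1;
  id2 : cell1 -> cell2;
  vcomp : cell2 -> cell2 -> cell2;
  hcomp : cell2 -> cell2 -> cell2;
  src1_tgt2 : forall a, src1 (tgt2 a) = src1 (src2 a);
  tgt1_tgt2 : forall a, tgt1 (tgt2 a) = tgt1 (src2 a);
  src1_id : forall x, src1 (id1 x) = x;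
  tgt1_id : forall x, tgt1 (id1 x) = x;
  src1_comp : forall g f, tgt1 f = src1 g -> src1 (comp1 g f) = src1 f;
  tgt1_comp : forall g f, tgt1 f = src1 g -> tgt1 (comp1 g f) = tgt1 g;
  comp1A : forall h g f, tgt1 f = src1 g -> tgt1 g = src1 h ->
    comp1 h (comp1 g f) = comp1 (comp1 h g) f;
  comp1_idl : forall f, comp1 (id1 (tgt1 f)) f = f;
  comp1_idr : forall f, comp1 f (id1 (src1 f)) = f;
  src2_id : forall f, src2 (id2 f) = f;
  tgt2_id : forall f, tgt2 (id2 f) = f;
  src2_vcomp : forall b a, tgt2 a = src2 b -> src2 (vcomp b a) = src2 a;
  tgt2_vcomp : forall b a, tgt2 a = src2 b -> tgt2 (vcomp b a) = tgt2 b;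
  vcompA : forall c b a, tgt2 a = src2 b -> tgt2 b = src2 c ->
    vcomp c (vcomp b a) = vcomp (vcomp c b) a;
  vcomp_idl : forall a, vcomp (id2 (tgt2 a)) a = a;
  vcomp_idr : forall a, vcomp a (id2 (src2 a)) = a;
  src2_hcomp : forall b a, tgt1 (src2 a) = src1 (src2 b) ->
    src2 (hcomp b a) = comp1 (src2 b) (src2 a);
  tgt2_hcomp : forall b a, tgt1 (src2 a) = src1 (src2 b) ->
    tgt2 (hcomp b a) = comp1 (tgt2 b) (tgt2 a);
  hcompA : forall c b a,
    tgt1 (src2 a) = src1 (src2 b) -> tgt1 (src2 b) = src1 (src2 c) ->
    hcomp c (hcomp b a) = hcomp (hcomp c b) a;
  hcomp_idl : forall a, hcomp (id2 (id1 (tgt1 (src2 a)))) a = a;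
  hcomp_idr : forall a, hcomp a (id2 (id1 (src1 (src2 a)))) = a;
  hcomp_id2 : forall g f, tgt1 f = src1 g ->
    hcomp (id2 g) (id2 f) = id2 (comp1 g f);
  hcomp_vcomp : forall b' b a' a, tgt2 a = src2 a' -> tgt2 b = src2 b' ->
    tgt1 (src2 a) = src1 (src2 b) ->
    hcomp (vcomp b' b) (vcomp a' a) = vcomp (hcomp b' a') (hcomp b a)
}.

Notation "g *1 f" := (comp1 g f)
  (at level 40, left associativity) : twocat_scope.
Notation "b *h a" := (hcomp b a)
  (at level 40, left associativity) : twocat_scope.
Notation "f *> a" := (hcomp (id2 f) a)
  (at level 40, left associativity) : twocat_scope.
Notation "a <* f" := (hcomp a (id2 f))
  (at level 40, left associativity) : twocat_scope.
Notation "b *v a" := (vcomp b a)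
  (at level 50, left associativity) : twocat_scope.

Record two_functor (C D : two_cat) := TwoFunctor {
  fun0 :> cell0 C -> cell0 D;
  fun1 : cell1 C -> cell1 D;
  fun2 : cell2 C -> cell2 D;
  fun_src1 : forall f, src1 (fun1 f) = fun0 (src1 f);
  fun_tgt1 : forall f, tgt1 (fun1 f) = fun0 (tgt1 f);
  fun_src2 : forall a, src2 (fun2 a) = fun1 (src2 a);
  fun_tgt2 : forall a, tgt2 (fun2 a) = fun1 (tgt2 a);
  fun_id1 : forall x, fun1 (id1 x) = id1 (fun0 x);
  fun_comp1 : forall g f, tgt1 f = src1 g -> fun1 (g *1 f) = fun1 g *1 fun1 f;
  fun_id2 : forall f, fun2 (id2 f) = id2 (fun1 f);
  fun_vcomp : forall b a, tgt2 a = src2 b -> fun2 (b *v a) = fun2 b *v fun2 a;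
  fun_hcomp : forall b a, tgt1 (src2 a) = src1 (src2 b) ->
    fun2 (b *h a) = fun2 b *h fun2 a
}.

(** The 2-cell [lt1 h : lt0 B *1 S h => R h *1 lt0 A] at [h : A -> B]. *)
Record lax_transf (C D : two_cat) := LaxTransf {
  lt_src : two_functor C D;
  lt_tgt : two_functor C D;
  lt0 : cell0 C -> cell1 D;
  lt1 : cell1 C -> cell2 D;
  lt_src0 : forall x, src1 (lt0 x) = lt_src x;
  lt_tgt0 : forall x, tgt1 (lt0 x) = lt_tgt x;
  lt_src1 : forall h, src2 (lt1 h) = lt0 (tgt1 h) *1 fun1 lt_src h;
  lt_tgt1 : forall h, tgt2 (lt1 h) = fun1 lt_tgt h *1 lt0 (src1 h);
  lt_nat : forall a,
    (fun2 lt_tgt a <* lt0 (src1 (src2 a))) *v lt1 (src2 a) =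
    lt1 (tgt2 a) *v (lt0 (tgt1 (src2 a)) *> fun2 lt_src a);
  lt_id : forall x, lt1 (id1 x) = id2 (lt0 x);
  lt_comp : forall k h, tgt1 h = src1 k ->
    lt1 (k *1 h) = (fun1 lt_tgt k *> lt1 h) *v (lt1 k <* fun1 lt_src h)
}.

Record modification (C D : two_cat) := Modification {
  md_src : lax_transf C D;
  md_tgt : lax_transf C D;
  md0 : cell0 C -> cell2 D;
  md_par_src : lt_src md_tgt = lt_src md_src;
  md_par_tgt : lt_tgt md_tgt = lt_tgt md_src;
  md_src0 : forall x, src2 (md0 x) = lt0 md_src x;
  md_tgt0 : forall x, tgt2 (md0 x) = lt0 md_tgt x;
  md_nat : forall h,
    (fun1 (lt_tgt md_src) h *> md0 (src1 h)) *v lt1 md_src h =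
    lt1 md_tgt h *v (md0 (tgt1 h) <* fun1 (lt_src md_src) h)
}.

Section ExtLemmas.
Variables C D : two_cat.

Lemma two_functor_ext (F G : two_functor C D) :
  fun0 F =1 fun0 G -> fun1 F =1 fun1 G -> fun2 F =1 fun2 G -> F = G.
Proof.
case: F => F0 F1 F2 ? ? ? ? ? ? ? ? ?; case: G => G0 G1 G2 ? ? ? ? ? ? ? ? ? /=.
move=> /funext E0 /funext E1 /funext E2; subst G0 G1 G2.
by congr TwoFunctor; apply: Prop_irrelevance.
Qed.

Lemma lax_transf_ext (f g : lax_transf C D) :
  lt_src f = lt_src g -> lt_tgt f = lt_tgt g ->
  lt0 f =1 lt0 g -> lt1 f =1 lt1 g -> f = g.
Proof.
case: f => S R f0 f1 ? ? ? ? ? ? ?; case: g => S' R' g0 g1 ? ? ? ? ? ? ? /=.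
move=> E E' /funext E0 /funext E1; subst S' R' g0 g1.
by congr LaxTransf; apply: Prop_irrelevance.
Qed.

Lemma modification_ext (m n : modification C D) :
  md_src m = md_src n -> md_tgt m = md_tgt n -> md0 m =1 md0 n -> m = n.
Proof.
case: m => f g m0 ? ? ? ? ?; case: n => f' g' n0 ? ? ? ? ? /=.
move=> E E' /funext E0; subst f' g' n0.
by congr Modification; apply: Prop_irrelevance.
Qed.

End ExtLemmas.

Ltac bd_step := first
  [ rewrite fun_src1 | rewrite fun_tgt1 | rewrite fun_src2 | rewrite fun_tgt2
  | rewrite src1_id | rewrite tgt1_id | rewrite src2_id | rewrite tgt2_id
  | rewrite lt_src0 | rewrite lt_tgt0 | rewrite lt_src1 | rewrite lt_tgt1
  | rewrite md_src0 | rewrite md_tgt0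
  | rewrite src1_tgt2 | rewrite tgt1_tgt2
  | match goal with e : @eq (two_functor _ _) _ _ |- _ => rewrite e end
  | match goal with e : @eq (lax_transf _ _) _ _ |- _ => rewrite e end ].
Ltac bd := repeat first
  [ bd_step
  | rewrite src1_comp; [|solve [bd]] | rewrite tgt1_comp; [|solve [bd]]
  | rewrite src2_vcomp; [|solve [bd]] | rewrite tgt2_vcomp; [|solve [bd]]
  | rewrite src2_hcomp; [|solve [bd]] | rewrite tgt2_hcomp; [|solve [bd]]
  | rewrite fun_comp1; [|solve [bd]]
  | rewrite comp1A; [|solve [bd]|solve [bd]] ]; first [done | congruence].

Section Whiskering.
Variable C : two_cat.
Implicit Types (f g : cell1 C) (a b : cell2 C).

Lemma vcomp_id2 f : id2 f *v id2 f = id2 f.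
Proof. by have := vcomp_idl (id2 f); rewrite tgt2_id. Qed.

Lemma wl_vcomp f b a : tgt2 a = src2 b -> tgt1 (src2 a) = src1 f ->
  f *> (b *v a) = (f *> b) *v (f *> a).
Proof.
move=> E1 E2; rewrite -hcomp_vcomp ?tgt2_id ?src2_id //.
by rewrite vcomp_id2.
Qed.

Lemma wr_vcomp f b a : tgt2 a = src2 b -> tgt1 f = src1 (src2 a) ->
  (b *v a) <* f = (b <* f) *v (a <* f).
Proof.
move=> E1 E2; rewrite -hcomp_vcomp ?tgt2_id ?src2_id //.
by rewrite vcomp_id2.
Qed.

Lemma wl_comp g f a : tgt1 (src2 a) = src1 f -> tgt1 f = src1 g ->
  (g *1 f) *> a = g *> (f *> a).
Proof. by move=> E1 E2; rewrite hcompA ?hcomp_id2 ?src2_id. Qed.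

Lemma wr_comp g f a : tgt1 f = src1 g -> tgt1 g = src1 (src2 a) ->
  a <* (g *1 f) = (a <* g) <* f.
Proof. by move=> E1 E2; rewrite -hcompA ?hcomp_id2 ?src2_id. Qed.

Lemma wlr g f a : tgt1 f = src1 (src2 a) -> tgt1 (src2 a) = src1 g ->
  (g *> a) <* f = g *> (a <* f).
Proof. by move=> E1 E2; rewrite -hcompA ?src2_id. Qed.

Lemma hcomp_wlr b a : tgt1 (src2 a) = src1 (src2 b) ->
  (tgt2 b *> a) *v (b <* src2 a) = b *h a.
Proof.
move=> E; rewrite -hcomp_vcomp ?tgt2_id ?src2_id ?vcomp_idl ?vcomp_idr //.
Qed.

Lemma hcomp_wrl b a : tgt1 (src2 a) = src1 (src2 b) ->
  (b <* tgt2 a) *v (src2 b *> a) = b *h a.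
Proof.
move=> E; rewrite -hcomp_vcomp ?tgt2_id ?src2_id ?vcomp_idl ?vcomp_idr //.
Qed.

End Whiskering.

#[local] Obligation Tactic := idtac.

Section LaxHom.
Variables C D : two_cat.

Program Definition lt_one (F : two_functor C D) : lax_transf C D :=
  @LaxTransf C D F F (fun x => id1 (F x)) (fun h => id2 (fun1 F h))
    _ _ _ _ _ _ _.
Next Obligation. by move=> F x /=; bd. Qed.
Next Obligation. by move=> F x /=; bd. Qed.
Next Obligation. by move=> F h /=; rewrite src2_id -fun_tgt1 comp1_idl. Qed.
Next Obligation. by move=> F h /=; rewrite tgt2_id -fun_src1 comp1_idr. Qed.
Next Obligation.
move=> F a /=.
have E : src1 (src2 (fun2 F a)) = F (src1 (src2 a)) by bd.
have E' : tgt1 (src2 (fun2 F a)) = F (tgt1 (src2 a)) by bd.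
by rewrite -E hcomp_idr -E' hcomp_idl -fun_src2 -fun_tgt2 vcomp_idl vcomp_idr.
Qed.
Next Obligation. by move=> F x /=; rewrite fun_id1. Qed.
Next Obligation.
move=> F k h H /=; rewrite fun_comp1 // !hcomp_id2; [|solve [bd]..].
by rewrite vcomp_id2.
Qed.

Program Definition lt_mul (g f : lax_transf C D) (e : lt_tgt f = lt_src g) :
    lax_transf C D :=
  @LaxTransf C D (lt_src f) (lt_tgt g)
    (fun x => lt0 g x *1 lt0 f x)
    (fun h => (lt1 g h <* lt0 f (src1 h)) *v (lt0 g (tgt1 h) *> lt1 f h))
    _ _ _ _ _ _ _.
Next Obligation. by move=> g f e x /=; bd. Qed.
Next Obligation. by move=> g f e x /=; bd. Qed.
Next Obligation. by move=> g f e h /=; rewrite src2_vcomp; bd. Qed.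
Next Obligation. by move=> g f e h /=; rewrite tgt2_vcomp; bd. Qed.
Next Obligation.
move=> g f e a /=; rewrite src1_tgt2 tgt1_tgt2.
set A := src1 (src2 a); set B := tgt1 (src2 a).
rewrite wr_comp ?vcompA -?wr_vcomp -?lt_nat; [|solve [bd]..].
rewrite lt_nat wr_vcomp ?wlr -?vcompA; [|solve [bd]..].
rewrite -wl_vcomp -?e ?lt_nat ?wl_vcomp ?e; [|solve [bd]..].
by rewrite wl_comp //; bd.
Qed.
Next Obligation.
move=> g f e x /=; rewrite !lt_id src1_id tgt1_id !hcomp_id2; [|solve [bd]..].
by rewrite vcomp_id2.
Qed.
Next Obligation.
move=> g f e k h H /=; rewrite !lt_comp // ?src1_comp // ?tgt1_comp //.
rewrite wl_vcomp; [|solve [bd]..].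
rewrite wl_vcomp; [|solve [bd]..].
rewrite wr_vcomp; [|solve [bd]..].
rewrite wr_vcomp; [|solve [bd]..].
rewrite e -!vcompA; [|solve [bd]..].
have E : (lt1 g k <* fun1 (lt_src g) h) <* lt0 f (src1 h) *v
    (lt0 g (tgt1 k) *> (fun1 (lt_src g) k *> lt1 f h)) =
  (fun1 (lt_tgt g) k *> (lt0 g (tgt1 h) *> lt1 f h)) *v
    ((lt1 g k <* lt0 f (src1 k)) <* fun1 (lt_src f) h).
  rewrite -wr_comp; [|solve [bd]..].
  rewrite -wr_comp; [|solve [bd]..].
  rewrite -wl_comp; [|solve [bd]..].
  rewrite -wl_comp; [|solve [bd]..].
  have -> : lt0 g (tgt1 k) *1 fun1 (lt_src g) k = src2 (lt1 g k) by bd.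
  have -> : fun1 (lt_src g) h *1 lt0 f (src1 h) = tgt2 (lt1 f h) by bd.
  by rewrite hcomp_wrl; [rewrite -hcomp_wlr; bd | bd].
rewrite wlr; [|solve [bd]..].
congr vcomp.
rewrite vcompA; [|solve [bd]..].
rewrite E -vcompA; [|solve [bd]..].
by rewrite wlr; [|solve [bd]..].
Qed.

Program Definition md_one (f : lax_transf C D) : modification C D :=
  @Modification C D f f (fun x => id2 (lt0 f x)) _ _ _ _ _.
Next Obligation. by []. Qed.
Next Obligation. by []. Qed.
Next Obligation. by move=> f x /=; rewrite src2_id. Qed.
Next Obligation. by move=> f x /=; rewrite tgt2_id. Qed.
Next Obligation.
move=> f h /=; rewrite hcomp_id2; [|solve [bd]..].
rewrite hcomp_id2; [|solve [bd]..].
by rewrite -lt_src1 -lt_tgt1 vcomp_idl vcomp_idr.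
Qed.

Program Definition md_vmul (n m : modification C D) (e : md_tgt m = md_src n) :
    modification C D :=
  @Modification C D (md_src m) (md_tgt n) (fun x => md0 n x *v md0 m x)
    _ _ _ _ _.
Next Obligation. by move=> n m e; rewrite md_par_src -e md_par_src. Qed.
Next Obligation. by move=> n m e; rewrite md_par_tgt -e md_par_tgt. Qed.
Next Obligation. by move=> n m e x; rewrite src2_vcomp ?md_src0 ?md_tgt0 ?e. Qed.
Next Obligation. by move=> n m e x; rewrite tgt2_vcomp ?md_src0 ?md_tgt0 ?e. Qed.
Next Obligation.
move=> n m e h /=.
have es : lt_src (md_src m) = lt_src (md_src n) by rewrite -e md_par_src.
have et : lt_tgt (md_src m) = lt_tgt (md_src n) by rewrite -e md_par_tgt.
have ns := md_par_src n; have nt := md_par_tgt n.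
rewrite wl_vcomp; [|solve [bd]..].
rewrite wr_vcomp; [|solve [bd]..].
rewrite -vcompA; [|solve [bd]..].
rewrite md_nat e et es vcompA; [|solve [bd]..].
by rewrite md_nat vcompA; [|solve [bd]..].
Qed.

Lemma md_hmul_tgt (n m : modification C D) :
  lt_tgt (md_src m) = lt_src (md_src n) -> lt_tgt (md_tgt m) = lt_src (md_tgt n).
Proof. by rewrite md_par_src md_par_tgt. Qed.

Program Definition md_hmul (n m : modification C D)
    (e : lt_tgt (md_src m) = lt_src (md_src n)) : modification C D :=
  @Modification C D (lt_mul e) (lt_mul (md_hmul_tgt e))
    (fun x => md0 n x *h md0 m x) _ _ _ _ _.
Next Obligation. by move=> n m e /=; rewrite md_par_src. Qed.
Next Obligation. by move=> n m e /=; rewrite md_par_tgt. Qed.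
Next Obligation. by move=> n m e x /=; bd. Qed.
Next Obligation. by move=> n m e x /=; bd. Qed.
Next Obligation.
move=> n m e h /=.
have ms := md_par_src m; have mt := md_par_tgt m.
have ns := md_par_src n; have nt := md_par_tgt n.
rewrite -[md0 n (src1 h) *h _]hcomp_wrl; [|solve [bd]..].
rewrite md_tgt0 md_src0 wl_vcomp; [|solve [bd]..].
rewrite -vcompA; [|solve [bd]..].
have E1 : (fun1 (lt_tgt (md_src n)) h *> (lt0 (md_src n) (src1 h) *> md0 m (src1 h)))
    *v (lt1 (md_src n) h <* lt0 (md_src m) (src1 h)) =
  (lt1 (md_src n) h <* lt0 (md_tgt m) (src1 h)) *v
  (lt0 (md_src n) (tgt1 h) *> (fun1 (lt_src (md_src n)) h *> md0 m (src1 h))).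
  rewrite -wl_comp; [|solve [bd]..].
  rewrite -wl_comp; [|solve [bd]..].
  rewrite -lt_tgt1 -lt_src1 -md_src0 -md_tgt0.
  by rewrite hcomp_wlr; [rewrite hcomp_wrl; bd | bd].
rewrite [X in _ *v X]vcompA; [|solve [bd]..].
rewrite E1 -[X in _ *v X]vcompA; [|solve [bd]..].
rewrite -e -wl_vcomp; [|solve [bd]..].
rewrite md_nat wl_vcomp; [|solve [bd]..].
rewrite vcompA; [|solve [bd]..].
rewrite -wlr; [|solve [bd]..].
rewrite -wr_vcomp; [|solve [bd]..].
rewrite md_nat wr_vcomp; [|solve [bd]..].
rewrite -!vcompA; [|solve [bd]..].
congr vcomp.
have E2 : ((md0 n (tgt1 h) <* fun1 (lt_src (md_src n)) h)
      <* lt0 (md_tgt m) (src1 h)) *v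
    (lt0 (md_src n) (tgt1 h) *> lt1 (md_tgt m) h) =
  (lt0 (md_tgt n) (tgt1 h) *> lt1 (md_tgt m) h) *v
  ((md0 n (tgt1 h) <* lt0 (md_tgt m) (tgt1 h)) <* fun1 (lt_src (md_src m)) h).
  rewrite -wr_comp; [|solve [bd]..].
  rewrite -wr_comp; [|solve [bd]..].
  rewrite -e -mt -ms -lt_tgt1 -lt_src1 -md_src0 -md_tgt0.
  by rewrite hcomp_wlr; [rewrite hcomp_wrl; bd | bd].
rewrite vcompA; [|solve [bd]..].
rewrite E2 -vcompA; [|solve [bd]..].
rewrite -wlr; [|solve [bd]..].
rewrite -wr_vcomp; [|solve [bd]..].
by rewrite -(md_tgt0 m) -(md_src0 n) hcomp_wrl; [|bd].
Qed.

(** Composites of non-composable arguments are set to the second argument. *)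
Definition lt_comp1 (g f : lax_transf C D) : lax_transf C D :=
  if pselect (lt_tgt f = lt_src g) is left e then lt_mul e else f.

Definition md_vcomp (n m : modification C D) : modification C D :=
  if pselect (md_tgt m = md_src n) is left e then md_vmul e else m.

Definition md_hcomp (n m : modification C D) : modification C D :=
  if pselect (lt_tgt (md_src m) = lt_src (md_src n)) is left e
  then md_hmul e else m.

Lemma lt_comp1E g f (e : lt_tgt f = lt_src g) : lt_comp1 g f = lt_mul e.
Proof.
by rewrite /lt_comp1; case: pselect => // e'; rewrite (Prop_irrelevance e e').
Qed.

Lemma md_vcompE n m (e : md_tgt m = md_src n) : md_vcomp n m = md_vmul e.
Proof.
by rewrite /md_vcomp; case: pselect => // e'; rewrite (Prop_irrelevance e e').
Qed.

Lemma md_hcompE n m (e : lt_tgt (md_src m) = lt_src (md_src n)) :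
  md_hcomp n m = md_hmul e.
Proof.
by rewrite /md_hcomp; case: pselect => // e'; rewrite (Prop_irrelevance e e').
Qed.

Lemma lt_mulA h g f (e1 : lt_tgt f = lt_src g) (e2 : lt_tgt g = lt_src h)
    (e3 : lt_tgt (lt_mul e1) = lt_src h) (e4 : lt_tgt f = lt_src (lt_mul e2)) :
  lt_mul e3 = lt_mul e4.
Proof.
apply: lax_transf_ext => //= [x|k]; clear e3 e4.
  by rewrite comp1A; bd.
rewrite wl_vcomp; [|solve [bd]..].
rewrite wr_vcomp; [|solve [bd]..].
rewrite wr_comp; [|solve [bd]..].
rewrite wl_comp; [|solve [bd]..].
rewrite vcompA; [|solve [bd]..].
by rewrite wlr; [|solve [bd]..].
Qed.

Lemma lt_mul1l F f (e : lt_tgt f = lt_src (lt_one F)) : lt_mul e = f.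
Proof.
have /= E := esym e; subst F.
apply: lax_transf_ext => //= [x|k]; clear e.
  by rewrite -lt_tgt0 comp1_idl.
rewrite hcomp_id2; [|solve [bd]..].
have -> : lt_tgt f (tgt1 k) = tgt1 (src2 (lt1 f k)) by bd.
by rewrite hcomp_idl -lt_tgt1 vcomp_idl.
Qed.

Lemma lt_mul1r F f (e : lt_tgt (lt_one F) = lt_src f) : lt_mul e = f.
Proof.
have /= E := e; subst F.
apply: lax_transf_ext => //= [x|k]; clear e.
  by rewrite -lt_src0 comp1_idr.
rewrite hcomp_id2; [|solve [bd]..].
have -> : lt_src f (src1 k) = src1 (src2 (lt1 f k)) by bd.
by rewrite hcomp_idr -lt_src1 vcomp_idr.
Qed.

(** The 2-category [P_L(C, D)] of 2-functors, lax natural transformations and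
    modifications. *)
Program Definition lax_hom : two_cat :=
  @TwoCat (two_functor C D) (lax_transf C D) (modification C D)
    (@lt_src C D) (@lt_tgt C D) (@md_src C D) (@md_tgt C D)
    lt_one lt_comp1 md_one md_vcomp md_hcomp
    _ _ _ _ _ _ _ _ _ _ _ _ _ _ _ _ _ _ _ _ _ _ _.
Next Obligation. exact: md_par_src. Qed.
Next Obligation. exact: md_par_tgt. Qed.
Next Obligation. by []. Qed.
Next Obligation. by []. Qed.
Next Obligation. by move=> g f e; rewrite (lt_comp1E e). Qed.
Next Obligation. by move=> g f e; rewrite (lt_comp1E e). Qed.
Next Obligation.
move=> h g f e e'; rewrite (lt_comp1E e) (lt_comp1E e').
rewrite (lt_comp1E (e' : lt_tgt (lt_mul e) = lt_src h)).
rewrite (lt_comp1E (e : lt_tgt f = lt_src (lt_mul e'))).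
exact: lt_mulA.
Qed.
Next Obligation. by move=> f; rewrite lt_comp1E lt_mul1l. Qed.
Next Obligation. by move=> f; rewrite lt_comp1E lt_mul1r. Qed.
Next Obligation. by []. Qed.
Next Obligation. by []. Qed.
Next Obligation. by move=> n m e; rewrite (md_vcompE e). Qed.
Next Obligation. by move=> n m e; rewrite (md_vcompE e). Qed.
Next Obligation.
move=> l n m e e'; rewrite (md_vcompE e) (md_vcompE e').
rewrite (md_vcompE (e' : md_tgt (md_vmul e) = md_src l)).
rewrite (md_vcompE (e : md_tgt m = md_src (md_vmul e'))).
apply: modification_ext => //= x.
by rewrite vcompA; bd.
Qed.
Next Obligation.
move=> m.
rewrite (md_vcompE (erefl : md_tgt m = md_src (md_one (md_tgt m)))); apply: modification_ext => //= x.
by rewrite -md_tgt0 vcomp_idl.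
Qed.
Next Obligation.
move=> m.
rewrite (md_vcompE (erefl : md_tgt (md_one (md_src m)) = md_src m)); apply: modification_ext => //= x.
by rewrite -md_src0 vcomp_idr.
Qed.
Next Obligation.
by move=> n m e; rewrite (md_hcompE e) /= (lt_comp1E e).
Qed.
Next Obligation.
by move=> n m e; rewrite (md_hcompE e) /= (lt_comp1E (md_hmul_tgt e)).
Qed.
Next Obligation.
move=> l n m e e'; rewrite (md_hcompE e) (md_hcompE e').
rewrite (md_hcompE (e' : lt_tgt (md_src (md_hmul e)) = lt_src (md_src l))).
rewrite (md_hcompE (e : lt_tgt (md_src m) = lt_src (md_src (md_hmul e')))).
apply: modification_ext => /= [||x]; try exact: lt_mulA.
by rewrite hcompA; bd.
Qed.
Next Obligation.
move=> m.
rewrite (md_hcompE (erefl : lt_tgt (md_src m) =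
  lt_src (md_src (md_one (lt_one (lt_tgt (md_src m))))))).
apply: modification_ext => /= [||x]; try exact: lt_mul1l.
have -> : lt_tgt (md_src m) x = tgt1 (src2 (md0 m x)) by bd.
by rewrite hcomp_idl.
Qed.
Next Obligation.
move=> m.
rewrite (md_hcompE (erefl : lt_tgt (md_src
  (md_one (lt_one (lt_src (md_src m))))) = lt_src (md_src m))).
apply: modification_ext => /= [||x]; try exact: lt_mul1r.
have -> : lt_src (md_src m) x = src1 (src2 (md0 m x)) by bd.
by rewrite hcomp_idr.
Qed.
Next Obligation.
move=> g f e; rewrite (md_hcompE (e : lt_tgt (md_src (md_one f)) =
  lt_src (md_src (md_one g)))) (lt_comp1E e).
apply: modification_ext => //= [|x].
  by congr lt_mul; apply: Prop_irrelevance.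
by rewrite hcomp_id2; bd.
Qed.
Next Obligation.
move=> n' n m' m em en e.
have e' : lt_tgt (md_src m') = lt_src (md_src n').
  by rewrite -em -en md_par_src md_par_tgt.
rewrite (md_vcompE em) (md_vcompE en) (md_hcompE e) (md_hcompE e').
rewrite (md_hcompE (e : lt_tgt (md_src (md_vmul em)) =
  lt_src (md_src (md_vmul en)))).
have E : md_tgt (md_hmul e) = md_src (md_hmul e').
  rewrite /=; move: (md_hmul_tgt e) (e'); rewrite em en => *.
  by congr lt_mul; apply: Prop_irrelevance.
rewrite (md_vcompE E); apply: modification_ext => //= [|x].
  by congr lt_mul; apply: Prop_irrelevance.
by clear E; rewrite hcomp_vcomp; bd.
Qed.
End LaxHom.

(** A 2-functor [B (x)_L C -> D] is by definition of the tensor product a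
    2-functor [B -> P_L(C, D)]; composition is given in this transposed form. *)
Record laxgray_data := LaxGrayData {
  obj : Type;
  hom : obj -> obj -> two_cat;
  one : forall X, cell0 (hom X X);
  comp : forall X Y Z, two_functor (hom Y Z) (lax_hom (hom X Y) (hom X Z))
}.

Arguments one {l}.
Arguments comp {l}.

(** [compij x y] is the composite of an i-cell [x] of [hom Y Z] with a j-cell [y]
    of [hom X Y], that is, the image of the generator [x (x) y] of
    [hom Y Z (x)_L hom X Y].  So [comp00] composes 1-cells of the lax-Gray
    category, [comp01], [comp02], [comp10], [comp20] are the whiskerings, and
    [comp11 a b : a h' . g b => g' b . a h] is the interchange 3-cell of
    [a : g -> g'] and [b : h -> h']. *)
Section Composites.
Variables (C : laxgray_data) (X Y Z : obj C).

Definition comp00 (g : cell0 (hom Y Z)) (h : cell0 (hom X Y)) :=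
  fun0 (fun0 (comp X Y Z) g : two_functor _ _) h.
Definition comp01 (g : cell0 (hom Y Z)) (b : cell1 (hom X Y)) :=
  fun1 (fun0 (comp X Y Z) g : two_functor _ _) b.
Definition comp02 (g : cell0 (hom Y Z)) (B : cell2 (hom X Y)) :=
  fun2 (fun0 (comp X Y Z) g : two_functor _ _) B.
Definition comp10 (a : cell1 (hom Y Z)) (h : cell0 (hom X Y)) :=
  lt0 (fun1 (comp X Y Z) a : lax_transf _ _) h.
Definition comp11 (a : cell1 (hom Y Z)) (b : cell1 (hom X Y)) :=
  lt1 (fun1 (comp X Y Z) a : lax_transf _ _) b.
Definition comp20 (A : cell2 (hom Y Z)) (h : cell0 (hom X Y)) :=
  md0 (fun2 (comp X Y Z) A : modification _ _) h.

End Composites.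

Declare Scope laxgray_scope.
Delimit Scope laxgray_scope with lg.
Local Open Scope laxgray_scope.

Notation "x *00 y" := (comp00 x y)
  (at level 39, left associativity) : laxgray_scope.
Notation "x *01 y" := (comp01 x y)
  (at level 39, left associativity) : laxgray_scope.
Notation "x *02 y" := (comp02 x y)
  (at level 39, left associativity) : laxgray_scope.
Notation "x *10 y" := (comp10 x y)
  (at level 39, left associativity) : laxgray_scope.
Notation "x *11 y" := (comp11 x y)
  (at level 39, left associativity) : laxgray_scope.
Notation "x *20 y" := (comp20 x y)
  (at level 39, left associativity) : laxgray_scope.

(** The unit and associativity diagrams of an enriched category compare
    2-functors out of [1 (x)_L hom X Y], [hom X Y (x)_L 1] and
    [hom Z W (x)_L hom Y Z (x)_L hom X Y]; they are stated on the generating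
    cells of these tensor products.  Those of the triple product are the
    [x (x) y (x) z] with dimensions of sum at most two. *)
Record laxgray_cat := LaxGrayCat {
  lg_data :> laxgray_data;
  unitl0 : forall (X Y : obj lg_data) (h : cell0 (hom X Y)), one Y *00 h = h;
  unitl1 : forall (X Y : obj lg_data) (b : cell1 (hom X Y)), one Y *01 b = b;
  unitl2 : forall (X Y : obj lg_data) (B : cell2 (hom X Y)), one Y *02 B = B;
  unitr0 : forall (X Y : obj lg_data) (g : cell0 (hom X Y)), g *00 one X = g;
  unitr1 : forall (X Y : obj lg_data) (a : cell1 (hom X Y)), a *10 one X = a;
  unitr2 : forall (X Y : obj lg_data) (A : cell2 (hom X Y)), A *20 one X = A;
  assoc000 : forall (X Y Z W : obj lg_data) (f : cell0 (hom Z W))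
    (g : cell0 (hom Y Z)) (h : cell0 (hom X Y)),
    f *00 (g *00 h) = (f *00 g) *00 h;
  assoc001 : forall (X Y Z W : obj lg_data) (f : cell0 (hom Z W))
    (g : cell0 (hom Y Z)) (c : cell1 (hom X Y)),
    f *01 (g *01 c) = (f *00 g) *01 c;
  assoc010 : forall (X Y Z W : obj lg_data) (f : cell0 (hom Z W))
    (b : cell1 (hom Y Z)) (h : cell0 (hom X Y)),
    f *01 (b *10 h) = (f *01 b) *10 h;
  assoc100 : forall (X Y Z W : obj lg_data) (a : cell1 (hom Z W))
    (g : cell0 (hom Y Z)) (h : cell0 (hom X Y)),
    a *10 (g *00 h) = (a *10 g) *10 h;
  assoc002 : forall (X Y Z W : obj lg_data) (f : cell0 (hom Z W))
    (g : cell0 (hom Y Z)) (H : cell2 (hom X Y)),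
    f *02 (g *02 H) = (f *00 g) *02 H;
  assoc020 : forall (X Y Z W : obj lg_data) (f : cell0 (hom Z W))
    (B : cell2 (hom Y Z)) (h : cell0 (hom X Y)),
    f *02 (B *20 h) = (f *02 B) *20 h;
  assoc200 : forall (X Y Z W : obj lg_data) (A : cell2 (hom Z W))
    (g : cell0 (hom Y Z)) (h : cell0 (hom X Y)),
    A *20 (g *00 h) = (A *20 g) *20 h;
  assoc011 : forall (X Y Z W : obj lg_data) (f : cell0 (hom Z W))
    (b : cell1 (hom Y Z)) (c : cell1 (hom X Y)),
    f *02 (b *11 c) = (f *01 b) *11 c;
  assoc101 : forall (X Y Z W : obj lg_data) (a : cell1 (hom Z W))
    (g : cell0 (hom Y Z)) (c : cell1 (hom X Y)),
    a *11 (g *01 c) = (a *10 g) *11 c;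
  assoc110 : forall (X Y Z W : obj lg_data) (a : cell1 (hom Z W))
    (b : cell1 (hom Y Z)) (h : cell0 (hom X Y)),
    a *11 (b *10 h) = (a *11 b) *20 h
}.

(** Compatibility with composition is, likewise, stated on the generating cells
    of [hom Y Z (x)_L hom X Y]. *)
Record laxgray_functor (C D : laxgray_cat) := LaxGrayFunctor {
  lg_obj :> obj C -> obj D;
  lg_hom : forall X Y, two_functor (hom X Y) (hom (lg_obj X) (lg_obj Y));
  lg_one : forall X, lg_hom X X (one X) = one (lg_obj X);
  lg_comp00 : forall X Y Z (g : cell0 (hom Y Z)) (h : cell0 (hom X Y)),
    lg_hom X Z (g *00 h) = lg_hom Y Z g *00 lg_hom X Y h;
  lg_comp01 : forall X Y Z (g : cell0 (hom Y Z)) (b : cell1 (hom X Y)),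
    fun1 (lg_hom X Z) (g *01 b) = lg_hom Y Z g *01 fun1 (lg_hom X Y) b;
  lg_comp02 : forall X Y Z (g : cell0 (hom Y Z)) (B : cell2 (hom X Y)),
    fun2 (lg_hom X Z) (g *02 B) = lg_hom Y Z g *02 fun2 (lg_hom X Y) B;
  lg_comp10 : forall X Y Z (a : cell1 (hom Y Z)) (h : cell0 (hom X Y)),
    fun1 (lg_hom X Z) (a *10 h) = fun1 (lg_hom Y Z) a *10 lg_hom X Y h;
  lg_comp20 : forall X Y Z (A : cell2 (hom Y Z)) (h : cell0 (hom X Y)),
    fun2 (lg_hom X Z) (A *20 h) = fun2 (lg_hom Y Z) A *20 lg_hom X Y h;
  lg_comp11 : forall X Y Z (a : cell1 (hom Y Z)) (b : cell1 (hom X Y)),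
    fun2 (lg_hom X Z) (a *11 b) = fun1 (lg_hom Y Z) a *11 fun1 (lg_hom X Y) b
}.

Record monad_data (C : laxgray_data) (X : obj C) := MonadData {
  mT : cell0 (hom X X);
  meta : cell1 (hom X X);
  mmu : cell1 (hom X X);
  ma : cell2 (hom X X);
  mp : cell2 (hom X X);
  mq : cell2 (hom X X)
}.

Record is_laxgray_monad (C : laxgray_cat) (X : obj C) (T : cell0 (hom X X))
    (eta mu : cell1 (hom X X)) (a p q : cell2 (hom X X)) : Prop :=
  IsLaxGrayMonad {
  src_eta : src1 eta = one X;
  tgt_eta : tgt1 eta = T;
  src_mu : src1 mu = T *00 T;
  tgt_mu : tgt1 mu = T;
  src_a : src2 a = mu *1 (T *01 mu);
  tgt_a : tgt2 a = mu *1 (mu *10 T);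
  src_p : src2 p = mu *1 (T *01 eta);
  tgt_p : tgt2 p = id1 T;
  src_q : src2 q = id1 T;
  tgt_q : tgt2 q = mu *1 (eta *10 T);
  coh1 : (a <* mu *10 (T *00 T)) *v (mu *> mu *11 mu) *v (a <* (T *00 T) *01 mu)
    = (mu *> a *20 T) *v (a <* T *01 mu *10 T) *v (mu *> T *02 a);
  coh2 : (p <* eta) *v (mu *> eta *11 eta) *v (q <* eta) = id2 eta;
  coh3 : (mu *> p *20 T) *v (a <* T *01 eta *10 T) *v (mu *> T *02 q) = id2 mu;
  coh4 : (a <* eta *10 (T *00 T)) *v (mu *> eta *11 mu) *v (q <* mu)
    = mu *> q *20 T;
  coh5 : (p <* mu) *v (mu *> mu *11 eta) *v (a <* (T *00 T) *01 eta)
    = mu *> T *02 p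
}.

Record laxgray_monad (C : laxgray_cat) (X : obj C) := LaxGrayMonad {
  m_data :> monad_data X;
  m_laws : is_laxgray_monad (mT m_data) (meta m_data) (mmu m_data)
    (ma m_data) (mp m_data) (mq m_data)
}.

Definition image_monad_data (C D : laxgray_cat) (G : laxgray_functor C D)
    (X : obj C) (M : monad_data X) : monad_data (G X) :=
  let F := lg_hom G X X in
  MonadData (F (mT M)) (fun1 F (meta M)) (fun1 F (mmu M))
    (fun2 F (ma M)) (fun2 F (mp M)) (fun2 F (mq M)).

(** [Beta i j] is [T^i eta T^j] and [Bmu i j] is [T^i mu T^j], where [T^n] is
    represented by [n].  A 2-cell is a source [T^n] with a composable list of
    basic 2-cells, the first to be applied being the head. *)
Inductive basic := Beta of nat & nat | Bmu of nat & nat.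

Definition basic_code b :=
  match b with Beta i j => (true, i, j) | Bmu i j => (false, i, j) end.
Definition basic_decode c :=
  match c with (true, i, j) => Beta i j | (false, i, j) => Bmu i j end.
Lemma basic_codeK : cancel basic_code basic_decode. Proof. by case. Qed.
HB.instance Definition _ := Equality.copy basic (can_type basic_codeK).

Definition bsrc b := match b with Beta i j => i + j | Bmu i j => i + j.+2 end.
Definition btgt b := match b with Beta i j => i + j.+1 | Bmu i j => i + j.+1 end.

Definition basicl k b :=
  match b with Beta i j => Beta (k + i) j | Bmu i j => Bmu (k + i) j end.
Definition basicr b k :=
  match b with Beta i j => Beta i (j + k) | Bmu i j => Bmu i (j + k) end.

Fixpoint chain n (w : seq basic) : bool :=
  if w is b :: w' then (bsrc b == n) && chain (btgt b) w' else true.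

Definition string := {s : nat * seq basic | chain s.1 s.2}.

Definition ssrc (s : string) : nat := (val s).1.
Definition word (s : string) : seq basic := (val s).2.
Definition stgt (s : string) : nat := foldl (fun _ => btgt) (ssrc s) (word s).

Lemma basicl_src k b : bsrc (basicl k b) = k + bsrc b.
Proof. by case: b => i j /=; rewrite addnA. Qed.
Lemma basicl_tgt k b : btgt (basicl k b) = k + btgt b.
Proof. by case: b => i j /=; rewrite addnA. Qed.
Lemma basicr_src k b : bsrc (basicr b k) = bsrc b + k.
Proof. by case: b => i j /=; rewrite -?addSn addnA. Qed.
Lemma basicr_tgt k b : btgt (basicr b k) = btgt b + k.
Proof. by case: b => i j /=; rewrite -?addSn addnA. Qed.

Lemma chainl k n w : chain n w -> chain (k + n) (map (basicl k) w).
Proof.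
elim: w n => //= b w IH n /andP[/eqP <- /IH H].
by rewrite basicl_src basicl_tgt eqxx.
Qed.

Lemma chainr k n w : chain n w -> chain (n + k) (map (basicr^~ k) w).
Proof.
elim: w n => //= b w IH n /andP[/eqP <- /IH H].
by rewrite basicr_src basicr_tgt eqxx.
Qed.

Lemma chain_basic b : chain (bsrc b) [:: b].
Proof. by rewrite /= eqxx. Qed.

Definition sid n : string := exist _ (n, [::]) (erefl true).
Definition sbasic b : string := exist _ (bsrc b, [:: b]) (chain_basic b).
(** The composite is [s] when the words do not compose. *)
Definition scomp (t s : string) : string :=
  insubd s (ssrc s, word s ++ word t).
Definition sl k (s : string) : string :=
  exist _ (k + ssrc s, map (basicl k) (word s)) (chainl k (valP s)).
Definition sr (s : string) k : string :=
  exist _ (ssrc s + k, map (basicr^~ k) (word s)) (chainr k (valP s)).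

Definition seta := sbasic (Beta 0 0).
Definition smu := sbasic (Bmu 0 0).

Section Strings.
Implicit Types s t u : string.

Lemma string_ext s t : ssrc s = ssrc t -> word s = word t -> s = t.
Proof.
case: s t => [[n w] /= H] [[m v] /= K]; rewrite /ssrc /word /= => E E'.
exact/val_inj/(congr2 pair).
Qed.

Lemma chain_cat n v w :
  chain n (v ++ w) = chain n v && chain (foldl (fun _ => btgt) n v) w.
Proof. by elim: v n => //= b v IH n; rewrite IH andbA. Qed.

Lemma val_scomp t s : stgt s = ssrc t ->
  val (scomp t s) = (ssrc s, word s ++ word t).
Proof.
move=> E; rewrite /scomp val_insubd /= chain_cat (valP s) /=.
by rewrite -/(stgt s) E (valP t).
Qed.

Lemma ssrc_comp t s : stgt s = ssrc t -> ssrc (scomp t s) = ssrc s.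
Proof. by move=> E; rewrite {1}/ssrc val_scomp. Qed.
Lemma word_comp t s : stgt s = ssrc t -> word (scomp t s) = word s ++ word t.
Proof. by move=> E; rewrite {1}/word val_scomp. Qed.
Lemma stgt_comp t s : stgt s = ssrc t -> stgt (scomp t s) = stgt t.
Proof.
move=> E; rewrite /stgt ssrc_comp // word_comp // foldl_cat -/(stgt s).
by rewrite E.
Qed.

Lemma scompA u t s : stgt s = ssrc t -> stgt t = ssrc u ->
  scomp u (scomp t s) = scomp (scomp u t) s.
Proof.
move=> E E'; have Es := ssrc_comp E'; have Et := stgt_comp E.
apply: string_ext; rewrite ?ssrc_comp ?word_comp ?ssrc_comp ?catA //;
  by rewrite ?Et ?Es.
Qed.

Lemma scomp_idl s : scomp (sid (stgt s)) s = s.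
Proof. by apply: string_ext; rewrite ?ssrc_comp ?word_comp ?cats0. Qed.
Lemma scomp_idr s : scomp s (sid (ssrc s)) = s.
Proof. by apply: string_ext; rewrite ?ssrc_comp ?word_comp. Qed.

Lemma stgtl k s : stgt (sl k s) = k + stgt s.
Proof.
have H w n : foldl (fun _ => btgt) (k + n) (map (basicl k) w) =
  k + foldl (fun _ => btgt) n w.
  by elim: w n => //= b w IH n; rewrite basicl_tgt IH.
exact: H.
Qed.
Lemma stgtr k s : stgt (sr s k) = stgt s + k.
Proof.
have H w n : foldl (fun _ => btgt) (n + k) (map (basicr^~ k) w) =
  foldl (fun _ => btgt) n w + k.
  by elim: w n => //= b w IH n; rewrite basicr_tgt IH.
exact: H.
Qed.

Lemma sl_id k n : sl k (sid n) = sid (k + n).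
Proof. exact: string_ext. Qed.
Lemma sr_id k n : sr (sid n) k = sid (n + k).
Proof. exact: string_ext. Qed.

Lemma sl_comp k t s : stgt s = ssrc t ->
  sl k (scomp t s) = scomp (sl k t) (sl k s).
Proof.
move=> E; have E' : stgt (sl k s) = ssrc (sl k t) by rewrite stgtl E.
apply: string_ext; first by rewrite ssrc_comp // /ssrc /= -/(ssrc _) ssrc_comp.
by rewrite word_comp // /word /= -/(word _) word_comp // map_cat.
Qed.
Lemma sr_comp k t s : stgt s = ssrc t ->
  sr (scomp t s) k = scomp (sr t k) (sr s k).
Proof.
move=> E; have E' : stgt (sr s k) = ssrc (sr t k) by rewrite stgtr E.
apply: string_ext; first by rewrite ssrc_comp // /ssrc /= -/(ssrc _) ssrc_comp.
by rewrite word_comp // /word /= -/(word _) word_comp // map_cat.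
Qed.

Lemma sl0 s : sl 0 s = s.
Proof. by apply: string_ext => //; rewrite /word /= map_id_in // => -[]. Qed.
Lemma sr0 s : sr s 0 = s.
Proof.
apply: string_ext; first by rewrite /ssrc /= addn0.
by rewrite /word /= map_id_in // => -[i j|i j] _ /=; rewrite addn0.
Qed.
Lemma slA k l s : sl k (sl l s) = sl (k + l) s.
Proof.
apply: string_ext; first by rewrite /ssrc /= addnA.
by rewrite /word /= -map_comp; apply: eq_map => -[i j|i j] /=; rewrite addnA.
Qed.
Lemma srA k l s : sr (sr s k) l = sr s (k + l).
Proof.
apply: string_ext; first by rewrite /ssrc /= addnA.
by rewrite /word /= -map_comp; apply: eq_map => -[i j|i j] /=; rewrite addnA.
Qed.
Lemma slr k l s : sl k (sr s l) = sr (sl k s) l.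
Proof.
apply: string_ext; first by rewrite /ssrc /= addnA.
by rewrite /word /= -!map_comp; apply: eq_map => -[i j|i j].
Qed.

End Strings.

(** 3-cells are the well-formed terms modulo [teq].  [Tint a b] is the
    interchange 3-cell of [a] and [b], [Tl k t] is [T^k t] and [Tr t k] is
    [t T^k]; whiskering by the 2-cell [s] is [Th] with [Tid s]. *)
Inductive term :=
| Ta | Tp | Tq
| Tint of string & string
| Tid of string
| Tv of term & term
| Th of term & term
| Tl of nat & term
| Tr of term & nat.

Fixpoint tsrc t : string :=
  match t with
  | Ta => scomp smu (sl 1 smu)
  | Tp => scomp smu (sl 1 seta)
  | Tq => sid 1
  | Tint a b => scomp (sr a (stgt b)) (sl (ssrc a) b)
  | Tid a => a
  | Tv u t => tsrc t
  | Th u t => scomp (tsrc u) (tsrc t)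
  | Tl k t => sl k (tsrc t)
  | Tr t k => sr (tsrc t) k
  end.

Fixpoint ttgt t : string :=
  match t with
  | Ta => scomp smu (sr smu 1)
  | Tp => sid 1
  | Tq => scomp smu (sr seta 1)
  | Tint a b => scomp (sl (stgt a) b) (sr a (ssrc b))
  | Tid a => a
  | Tv u t => ttgt u
  | Th u t => scomp (ttgt u) (ttgt t)
  | Tl k t => sl k (ttgt t)
  | Tr t k => sr (ttgt t) k
  end.

Fixpoint wf t : bool :=
  match t with
  | Ta | Tp | Tq | Tint _ _ | Tid _ => true
  | Tv u t => [&& wf u, wf t & ttgt t == tsrc u]
  | Th u t => [&& wf u, wf t & stgt (tsrc t) == ssrc (tsrc u)]
  | Tl _ t | Tr t _ => wf t
  end.

Declare Scope term_scope.
Delimit Scope term_scope with term.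
Notation "u *v t" := (Tv u t) (at level 50, left associativity) : term_scope.
Notation "u *h t" := (Th u t) (at level 40, left associativity) : term_scope.
Notation "s *> t" := (Th (Tid s) t) (at level 40, left associativity) : term_scope.
Notation "t <* s" := (Th t (Tid s)) (at level 40, left associativity) : term_scope.

Section TermEquality.
Local Open Scope term_scope.

(** The congruence generated by the axioms of a lax-Gray category (those of
    2-categories for the hom, 2-functoriality of [T^k -], of [- T^k] and of
    composition into [P_L], unit and associativity laws) and by the five
    coherence equations. *)
Inductive teq : term -> term -> Prop :=
| teq_refl t : teq t t
| teq_sym t u : teq t u -> teq u t
| teq_trans t u v : teq t u -> teq u v -> teq t v
| teq_v t t' u u' : teq t t' -> teq u u' -> teq (u *v t) (u' *v t')
| teq_h t t' u u' : teq t t' -> teq u u' -> teq (u *h t) (u' *h t')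
| teq_l k t t' : teq t t' -> teq (Tl k t) (Tl k t')
| teq_r k t t' : teq t t' -> teq (Tr t k) (Tr t' k)
| teq_vA v u t : wf (v *v (u *v t)) -> teq (v *v (u *v t)) (v *v u *v t)
| teq_vidl t : wf t -> teq (Tid (ttgt t) *v t) t
| teq_vidr t : wf t -> teq (t *v Tid (tsrc t)) t
| teq_hA v u t : wf (v *h (u *h t)) -> teq (v *h (u *h t)) (v *h u *h t)
| teq_hidl t : wf t -> teq (sid (stgt (tsrc t)) *> t) t
| teq_hidr t : wf t -> teq (t <* sid (ssrc (tsrc t))) t
| teq_hid b a : stgt a = ssrc b -> teq (b *> Tid a) (Tid (scomp b a))
| teq_hv u' u t' t : wf ((u' *v u) *h (t' *v t)) ->
    teq ((u' *v u) *h (t' *v t)) (u' *h t' *v u *h t)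
| teq_lid k a : teq (Tl k (Tid a)) (Tid (sl k a))
| teq_lv k u t : wf (u *v t) -> teq (Tl k (u *v t)) (Tl k u *v Tl k t)
| teq_lh k u t : wf (u *h t) -> teq (Tl k (u *h t)) (Tl k u *h Tl k t)
| teq_rid k a : teq (Tr (Tid a) k) (Tid (sr a k))
| teq_rv k u t : wf (u *v t) -> teq (Tr (u *v t) k) (Tr u k *v Tr t k)
| teq_rh k u t : wf (u *h t) -> teq (Tr (u *h t) k) (Tr u k *h Tr t k)
| teq_int_idr a n : teq (Tint a (sid n)) (Tid (sr a n))
| teq_int_idl n b : teq (Tint (sid n) b) (Tid (sl n b))
| teq_int_compr a b' b : stgt b = ssrc b' ->
    teq (Tint a (scomp b' b))
      (sl (stgt a) b' *> Tint a b *v Tint a b' <* sl (ssrc a) b)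
| teq_int_compl a' a b : stgt a = ssrc a' ->
    teq (Tint (scomp a' a) b)
      (Tint a' b <* sr a (ssrc b) *v sr a' (stgt b) *> Tint a b)
| teq_int_natr a t : wf t ->
    teq (Tl (stgt a) t <* sr a (ssrc (tsrc t)) *v Tint a (tsrc t))
      (Tint a (ttgt t) *v sr a (stgt (tsrc t)) *> Tl (ssrc a) t)
| teq_int_natl t b : wf t ->
    teq (sl (stgt (tsrc t)) b *> Tr t (ssrc b) *v Tint (tsrc t) b)
      (Tint (ttgt t) b *v Tr t (stgt b) <* sl (ssrc (tsrc t)) b)
| teq_l0 t : teq (Tl 0 t) t
| teq_r0 t : teq (Tr t 0) t
| teq_ll k l t : teq (Tl k (Tl l t)) (Tl (k + l) t)
| teq_rr k l t : teq (Tr (Tr t k) l) (Tr t (k + l))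
| teq_lr k l t : teq (Tl k (Tr t l)) (Tr (Tl k t) l)
| teq_l_int k a b : teq (Tl k (Tint a b)) (Tint (sl k a) b)
| teq_m_int a k b : teq (Tint a (sl k b)) (Tint (sr a k) b)
| teq_r_int a b k : teq (Tint a (sr b k)) (Tr (Tint a b) k)
| teq_coh1 :
    teq (Ta <* sr smu 2 *v smu *> Tint smu smu *v Ta <* sl 2 smu)
      (smu *> Tr Ta 1 *v Ta <* sr (sl 1 smu) 1 *v smu *> Tl 1 Ta)
| teq_coh2 :
    teq (Tp <* seta *v smu *> Tint seta seta *v Tq <* seta) (Tid seta)
| teq_coh3 :
    teq (smu *> Tr Tp 1 *v Ta <* sr (sl 1 seta) 1 *v smu *> Tl 1 Tq)
      (Tid smu)
| teq_coh4 :
    teq (Ta <* sr seta 2 *v smu *> Tint seta smu *v Tq <* smu)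
      (smu *> Tr Tq 1)
| teq_coh5 :
    teq (Tp <* smu *v smu *> Tint smu seta *v Ta <* sl 2 seta)
      (smu *> Tl 1 Tp).

End TermEquality.

Lemma wf_globular t : wf t ->
  ssrc (ttgt t) = ssrc (tsrc t) /\ stgt (ttgt t) = stgt (tsrc t).
Proof.
elim: t => //=.
- by rewrite !ssrc_comp // !stgt_comp.
- by rewrite !ssrc_comp // !stgt_comp.
- by rewrite !ssrc_comp // !stgt_comp.
- move=> a b _.
  have E1 : stgt (sl (ssrc a) b) = ssrc (sr a (stgt b)) by rewrite stgtl.
  have E2 : stgt (sr a (ssrc b)) = ssrc (sl (stgt a) b) by rewrite stgtr.
  by rewrite !ssrc_comp // !stgt_comp // stgtl stgtr.
- move=> u IHu t IHt /and3P[/IHu[? Eu] /IHt[Et ?] /eqP E].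
  by split; [rewrite -Et E | rewrite Eu -E].
- move=> u IHu t IHt /and3P[/IHu[Eu Eu'] /IHt[Et Et'] /eqP E].
  have E' : stgt (ttgt t) = ssrc (ttgt u) by rewrite Et' Eu.
  by rewrite !ssrc_comp // !stgt_comp.
- by move=> k t IH /IH[E E']; rewrite !stgtl E' /ssrc /= -!/(ssrc _) E.
- by move=> t IH k /IH[E E']; rewrite !stgtr E' /ssrc /= -!/(ssrc _) E.
Qed.

Lemma ssrc_ttgt t : wf t -> ssrc (ttgt t) = ssrc (tsrc t).
Proof. by case/wf_globular. Qed.
Lemma stgt_ttgt t : wf t -> stgt (ttgt t) = stgt (tsrc t).
Proof. by case/wf_globular. Qed.

Lemma ssrcl k s : ssrc (sl k s) = k + ssrc s. Proof. by []. Qed.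
Lemma ssrcr k s : ssrc (sr s k) = ssrc s + k. Proof. by []. Qed.
Lemma ssrcI n : ssrc (sid n) = n. Proof. by []. Qed.
Lemma stgtI n : stgt (sid n) = n. Proof. by []. Qed.
Lemma scomp_idl' n s : stgt s = n -> scomp (sid n) s = s.
Proof. by move<-; exact: scomp_idl. Qed.
Lemma scomp_idr' n s : ssrc s = n -> scomp s (sid n) = s.
Proof. by move<-; exact: scomp_idr. Qed.

Ltac sbd_step := first
  [ rewrite ssrcl | rewrite ssrcr | rewrite stgtl | rewrite stgtr
  | rewrite ssrcI | rewrite stgtI
  | rewrite ssrc_ttgt; [|done] | rewrite stgt_ttgt; [|done]
  | match goal with e : @eq string _ _ |- _ => rewrite e end ].
Ltac sbd := repeat first
  [ sbd_step
  | rewrite ssrc_comp; [|solve [sbd]] | rewrite stgt_comp; [|solve [sbd]] ];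
  first [done | congruence | rewrite ?addnA; congruence ].
Ltac scd := repeat first
  [ rewrite sl_comp; [|solve [sbd]] | rewrite sr_comp; [|solve [sbd]]
  | rewrite scompA; [|solve [sbd]|solve [sbd]] ].

Ltac ceq := scd; apply: string_ext;
  [sbd | repeat (rewrite word_comp; [|solve [sbd]]); done].
Ltac cwf := repeat match goal with
  | |- is_true (_ && _) => apply/andP; split
  | |- _ && _ = true => apply/andP; split end; apply/eqP; first [solve [sbd] | ceq].

Lemma teq_inv t u : teq t u ->
  [/\ wf t = wf u, tsrc t = tsrc u & ttgt t = ttgt u].
Proof.
elim=> {t u} //=.
- by move=> t u _ [].
- by move=> t u v _ [-> -> ->] _ [-> -> ->].
- by move=> t t' u u' _ [-> -> ->] _ [-> -> ->].
- by move=> t t' u u' _ [-> -> ->] _ [-> -> ->].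
- by move=> k t t' _ [-> -> ->].
- by move=> k t t' _ [-> -> ->].
- by move=> v u t /and3P[-> /and3P[-> -> ->] ->].
- by move=> t wt; rewrite wt eqxx.
- by move=> t wt; rewrite wt eqxx.
- move=> v u t /and3P[wv /and3P[wu wt /eqP E] /eqP].
  rewrite stgt_comp // => E'.
  rewrite wv wu wt ssrc_comp // E E' !eqxx.
  by split=> //; rewrite scompA //; sbd.
- move=> t wt; rewrite wt eqxx; split=> //; apply: scomp_idl' => //.
  exact: stgt_ttgt.
- move=> t wt; rewrite wt eqxx; split=> //; apply: scomp_idr' => //.
  exact: ssrc_ttgt.
- by move=> b a ->; rewrite eqxx.
- move=> u' u t' t /and3P[/and3P[wu' wu /eqP E] /and3P[wt' wt /eqP E'] /eqP F].
  have F' : stgt (tsrc t') = ssrc (tsrc u') by rewrite -E -E'; sbd.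
  by rewrite wu' wu wt' wt E E' F F' !eqxx.
- by move=> k u t /and3P[-> -> /eqP ->]; rewrite !eqxx.
- move=> k u t /and3P[wu wt /eqP E]; rewrite wu wt E eqxx.
  by rewrite stgtl E eqxx !sl_comp //; sbd.
- by move=> k u t /and3P[-> -> /eqP ->]; rewrite !eqxx.
- move=> k u t /and3P[wu wt /eqP E]; rewrite wu wt E eqxx.
  by rewrite stgtr E eqxx !sr_comp //; sbd.
- by move=> a n; rewrite !sl_id scomp_idl' ?scomp_idr'; sbd.
- by move=> n b; rewrite !sr_id scomp_idl' ?scomp_idr'; sbd.
- move=> a b' b E.
  split; first (symmetry; apply/and3P; split; apply/eqP).
  + by sbd.
  + by sbd.
  + by scd; sbd.
  + by scd; sbd.
  + by scd; sbd.
- move=> a' a b E.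
  split; first (symmetry; apply/and3P; split; apply/eqP).
  + by sbd.
  + by sbd.
  + by scd; sbd.
  + by scd; sbd.
  + by scd; sbd.
- move=> a t wt.
  rewrite wt !stgtr !stgtl !ssrcr !ssrcl !ssrc_ttgt // !stgt_ttgt // !eqxx.
  by [].
- move=> t b wt.
  rewrite wt !stgtr !stgtl !ssrcr !ssrcl !ssrc_ttgt // !stgt_ttgt // !eqxx.
  by [].
- by move=> t; rewrite !sl0.
- by move=> t; rewrite !sr0.
- by move=> k l t; rewrite !slA.
- by move=> k l t; rewrite !srA.
- by move=> k l t; rewrite !slr.
- move=> k a b; scd.
  by rewrite !slr !slA stgtl.
- move=> a k b.
  by rewrite stgtl !ssrcl !ssrcr stgtr !srA !slA.
- move=> a b k; scd.
  by rewrite !slr !srA stgtr.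
- by split; [transitivity true; [|symmetry]; cwf | ceq | ceq].
- by split; [cwf | ceq | ceq].
- by split; [cwf | ceq | ceq].
- by split; [transitivity true; [|symmetry]; cwf | ceq | ceq].
- by split; [transitivity true; [|symmetry]; cwf | ceq | ceq].
Qed.

HB.instance Definition _ := gen_eqMixin term.
HB.instance Definition _ := gen_choiceMixin term.

Definition wterm := {t : term | wf t}.

Definition wteq (t u : wterm) : bool := `[< teq (val t) (val u) >].

Lemma wteq_refl : reflexive wteq.
Proof. by move=> t; apply/asboolP; exact: teq_refl. Qed.
Lemma wteq_sym : symmetric wteq.
Proof. by move=> t u; apply/asboolP/asboolP; exact: teq_sym. Qed.
Lemma wteq_trans : transitive wteq.
Proof.
by move=> u t v /asboolP E /asboolP E'; apply/asboolP; exact: teq_trans E E'.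
Qed.
Canonical wteq_equiv := EquivRel wteq wteq_refl wteq_sym wteq_trans.

Definition cell3 := {eq_quot wteq}%qT.

(** The class of [t] if [t] is well-formed, and a dummy value otherwise. *)
Definition mk3 (t : term) : cell3 :=
  (\pi_({eq_quot wteq}) (insubd (exist _ (Tid (sid 0)) (erefl true) : wterm) t))%qT.
Definition rep3 (x : cell3) : term := val (repr x).

Lemma wf_rep3 x : wf (rep3 x). Proof. exact: valP. Qed.

Lemma mk3_eq t u : teq t u -> mk3 t = mk3 u.
Proof.
move=> E; have [Ew _ _] := teq_inv E.
apply/eqmodP/asboolP; rewrite !val_insubd -Ew; case: (wf t) => //.
exact: teq_refl.
Qed.

Lemma rep3K x : mk3 (rep3 x) = x.
Proof. by rewrite /mk3 /rep3 valKd reprK. Qed.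

Lemma rep3_mk3 t : wf t -> teq (rep3 (mk3 t)) t.
Proof.
move=> wt; suff /asboolP : wteq (repr (mk3 t)) (insubd (repr (mk3 t)) t).
  by rewrite val_insubd wt.
apply/eqmodP; rewrite reprK /mk3; congr (\pi _)%qT.
by apply: val_inj; rewrite !val_insubd wt.
Qed.

Lemma cell3_ind (P : cell3 -> Prop) :
  (forall t, wf t -> P (mk3 t)) -> forall x, P x.
Proof. by move=> H x; rewrite -[x]rep3K; exact/H/wf_rep3. Qed.

Definition src3 (x : cell3) : string := tsrc (rep3 x).
Definition tgt3 (x : cell3) : string := ttgt (rep3 x).
Definition id3 s : cell3 := mk3 (Tid s).
Definition v3 (y x : cell3) : cell3 := mk3 (Tv (rep3 y) (rep3 x)).
Definition h3 (y x : cell3) : cell3 := mk3 (Th (rep3 y) (rep3 x)).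
Definition l3 k (x : cell3) : cell3 := mk3 (Tl k (rep3 x)).
Definition r3 (x : cell3) k : cell3 := mk3 (Tr (rep3 x) k).
Definition int3 a b : cell3 := mk3 (Tint a b).

Lemma src3E t : wf t -> src3 (mk3 t) = tsrc t.
Proof. by move/rep3_mk3/teq_inv => []. Qed.
Lemma tgt3E t : wf t -> tgt3 (mk3 t) = ttgt t.
Proof. by move/rep3_mk3/teq_inv => []. Qed.
Lemma v3E u t : wf u -> wf t -> v3 (mk3 u) (mk3 t) = mk3 (Tv u t).
Proof. by move=> wu wt; apply: mk3_eq; apply: teq_v; apply: rep3_mk3. Qed.
Lemma h3E u t : wf u -> wf t -> h3 (mk3 u) (mk3 t) = mk3 (Th u t).
Proof. by move=> wu wt; apply: mk3_eq; apply: teq_h; apply: rep3_mk3. Qed.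
Lemma l3E k t : wf t -> l3 k (mk3 t) = mk3 (Tl k t).
Proof. by move=> wt; apply: mk3_eq; apply: teq_l; apply: rep3_mk3. Qed.
Lemma r3E k t : wf t -> r3 (mk3 t) k = mk3 (Tr t k).
Proof. by move=> wt; apply: mk3_eq; apply: teq_r; apply: rep3_mk3. Qed.

Lemma teq_hA' v u t : wf t -> wf u -> wf v ->
  stgt (tsrc t) = ssrc (tsrc u) -> stgt (tsrc u) = ssrc (tsrc v) ->
  teq (Th v (Th u t)) (Th (Th v u) t).
Proof.
move=> wt wu wv E E'; apply: teq_hA; rewrite /= wt wu wv E eqxx /=.
by rewrite stgt_comp ?E' ?eqxx.
Qed.

Program Definition mnd_hom : two_cat :=
  @TwoCat nat string cell3 ssrc stgt src3 tgt3
    sid scomp id3 v3 h3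
    _ _ _ _ _ _ _ _ _ _ _ _ _ _ _ _ _ _ _ _ _ _ _.
Next Obligation. by elim/cell3_ind=> t wt; rewrite src3E ?tgt3E // ssrc_ttgt. Qed.
Next Obligation. by elim/cell3_ind=> t wt; rewrite src3E ?tgt3E // stgt_ttgt. Qed.
Next Obligation. by []. Qed.
Next Obligation. by []. Qed.
Next Obligation. exact: ssrc_comp. Qed.
Next Obligation. exact: stgt_comp. Qed.
Next Obligation. by move=> *; rewrite scompA. Qed.
Next Obligation. exact: scomp_idl. Qed.
Next Obligation. exact: scomp_idr. Qed.
Next Obligation. by move=> s; rewrite src3E. Qed.
Next Obligation. by move=> s; rewrite tgt3E. Qed.
Next Obligation.
elim/cell3_ind=> u wu; elim/cell3_ind=> t wt.
rewrite (tgt3E wt) (src3E wu) => E; have w : wf (Tv u t) by rewrite /= wu wt E eqxx.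
by rewrite v3E // (src3E w) (src3E wt).
Qed.
Next Obligation.
elim/cell3_ind=> u wu; elim/cell3_ind=> t wt.
rewrite (tgt3E wt) (src3E wu) => E; have w : wf (Tv u t) by rewrite /= wu wt E eqxx.
by rewrite v3E // (tgt3E w) (tgt3E wu).
Qed.
Next Obligation.
elim/cell3_ind=> v wv; elim/cell3_ind=> u wu; elim/cell3_ind=> t wt.
rewrite (tgt3E wt) (src3E wu) (tgt3E wu) (src3E wv) => E E'.
have w : wf (Tv u t) by rewrite /= wu wt E eqxx.
have w' : wf (Tv v u) by rewrite /= wv wu E' eqxx.
rewrite (v3E wu wt) (v3E wv wu) (v3E wv w) (v3E w' wt); apply/mk3_eq/teq_vA.
by rewrite /= wu wt wv E E' !eqxx.
Qed.
Next Obligation.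
elim/cell3_ind=> t wt; rewrite (tgt3E wt) /id3 v3E //; exact/mk3_eq/teq_vidl.
Qed.
Next Obligation.
elim/cell3_ind=> t wt; rewrite (src3E wt) /id3 v3E //; exact/mk3_eq/teq_vidr.
Qed.
Next Obligation.
elim/cell3_ind=> u wu; elim/cell3_ind=> t wt.
rewrite !(src3E wt) !(src3E wu) => E; have w : wf (Th u t) by rewrite /= wu wt E eqxx.
by rewrite h3E // (src3E w).
Qed.
Next Obligation.
elim/cell3_ind=> u wu; elim/cell3_ind=> t wt.
rewrite (src3E wt) (src3E wu) => E; have w : wf (Th u t) by rewrite /= wu wt E eqxx.
by rewrite h3E // (tgt3E w) (tgt3E wt) (tgt3E wu).
Qed.
Next Obligation.
elim/cell3_ind=> v wv; elim/cell3_ind=> u wu; elim/cell3_ind=> t wt.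
rewrite (src3E wt) (src3E wu) (src3E wv) => E E'.
have w : wf (Th u t) by rewrite /= wu wt E eqxx.
have w' : wf (Th v u) by rewrite /= wv wu E' eqxx.
by rewrite (h3E wu wt) (h3E wv wu) (h3E wv w) (h3E w' wt); apply/mk3_eq/teq_hA'.
Qed.
Next Obligation.
elim/cell3_ind=> t wt; rewrite (src3E wt) /id3 h3E //; exact/mk3_eq/teq_hidl.
Qed.
Next Obligation.
elim/cell3_ind=> t wt; rewrite (src3E wt) /id3 h3E //; exact/mk3_eq/teq_hidr.
Qed.
Next Obligation. by move=> b a E; rewrite /id3 h3E //; exact/mk3_eq/teq_hid. Qed.
Next Obligation.
elim/cell3_ind=> u' wu'; elim/cell3_ind=> u wu.
elim/cell3_ind=> t' wt'; elim/cell3_ind=> t wt.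
rewrite (tgt3E wt) (tgt3E wu) (src3E wt') (src3E wu') (src3E wt) (src3E wu).
move=> E E' F.
have F' : stgt (tsrc t') = ssrc (tsrc u').
  by rewrite -E -E' stgt_ttgt // ssrc_ttgt.
have w1 : wf (Tv u' u) by rewrite /= wu wu' E' eqxx.
have w2 : wf (Tv t' t) by rewrite /= wt wt' E eqxx.
have w3 : wf (Th u t) by rewrite /= wt wu F eqxx.
have w4 : wf (Th u' t') by rewrite /= wt' wu' F' eqxx.
rewrite (v3E wu' wu) (v3E wt' wt) (h3E wu' wt') (h3E wu wt).
rewrite (h3E w1 w2) (v3E w4 w3).
by apply/mk3_eq/teq_hv; rewrite /= wu wu' wt wt' E E' F !eqxx.
Qed.

Program Definition mnd_l (k : nat) : two_functor mnd_hom mnd_hom :=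
  @TwoFunctor mnd_hom mnd_hom (addn k) (sl k) (l3 k) _ _ _ _ _ _ _ _ _.
Next Obligation. by []. Qed.
Next Obligation. exact: stgtl. Qed.
Next Obligation. by move=> k; elim/cell3_ind=> t wt; rewrite /= l3E // (src3E wt) src3E. Qed.
Next Obligation. by move=> k; elim/cell3_ind=> t wt; rewrite /= l3E // (tgt3E wt) tgt3E. Qed.
Next Obligation. exact: sl_id. Qed.
Next Obligation. exact: sl_comp. Qed.
Next Obligation. by move=> k s; rewrite /= /id3 l3E //; exact/mk3_eq/teq_lid. Qed.
Next Obligation.
move=> k; elim/cell3_ind=> u wu; elim/cell3_ind=> t wt /=.
rewrite (tgt3E wt) (src3E wu) => E.
have w : wf (Tv u t) by rewrite /= wu wt E eqxx.
by rewrite (v3E wu wt) (l3E _ wu) (l3E _ wt) (l3E _ w) v3E //; exact/mk3_eq/teq_lv.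
Qed.
Next Obligation.
move=> k; elim/cell3_ind=> u wu; elim/cell3_ind=> t wt /=.
rewrite (src3E wt) (src3E wu) => E.
have w : wf (Th u t) by rewrite /= wu wt E eqxx.
by rewrite (h3E wu wt) (l3E _ wu) (l3E _ wt) (l3E _ w) h3E //; exact/mk3_eq/teq_lh.
Qed.

Program Definition mnd_int (s : string) : lax_transf mnd_hom mnd_hom :=
  @LaxTransf mnd_hom mnd_hom (mnd_l (ssrc s)) (mnd_l (stgt s)) (sr s) (int3 s)
    _ _ _ _ _ _ _.
Next Obligation. by []. Qed.
Next Obligation. by move=> s n /=; rewrite stgtr. Qed.
Next Obligation. by move=> s b /=; rewrite src3E. Qed.
Next Obligation. by move=> s b /=; rewrite tgt3E. Qed.
Next Obligation.
move=> s; elim/cell3_ind=> t wt /=; rewrite (src3E wt) (tgt3E wt) !(l3E _ wt) /id3 /int3.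
have w1 : wf (Th (Tl (stgt s) t) (Tid (sr s (ssrc (tsrc t))))).
  by rewrite /= wt stgtr eqxx.
have w2 : wf (Th (Tid (sr s (stgt (tsrc t)))) (Tl (ssrc s) t)).
  by rewrite /= wt stgtl eqxx.
by rewrite !h3E // !v3E //; exact/mk3_eq/teq_int_natr.
Qed.
Next Obligation. by move=> s n; exact/mk3_eq/teq_int_idr. Qed.
Next Obligation.
move=> s b' b; rewrite -[tgt1 _]/(stgt b) -[src1 _]/(ssrc b') => E /=.
rewrite /id3 /int3.
have w1 : wf (Th (Tid (sl (stgt s) b')) (Tint s b)).
  by rewrite /= stgt_comp ?stgtl ?stgtr // ssrcl -E eqxx.
have w2 : wf (Th (Tint s b') (Tid (sl (ssrc s) b))).
  by rewrite /= ssrc_comp ?stgtl // ssrcl -E eqxx.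
by rewrite !h3E // !v3E //; exact/mk3_eq/teq_int_compr.
Qed.

Program Definition mnd_r (x : cell3) : modification mnd_hom mnd_hom :=
  @Modification mnd_hom mnd_hom (mnd_int (src3 x)) (mnd_int (tgt3 x)) (r3 x)
    _ _ _ _ _.
Next Obligation. by elim/cell3_ind=> t wt /=; rewrite src3E ?tgt3E ?ssrc_ttgt. Qed.
Next Obligation. by elim/cell3_ind=> t wt /=; rewrite src3E ?tgt3E ?stgt_ttgt. Qed.
Next Obligation. by elim/cell3_ind=> t wt n /=; rewrite r3E // (src3E wt) src3E. Qed.
Next Obligation. by elim/cell3_ind=> t wt n /=; rewrite r3E // (tgt3E wt) tgt3E. Qed.
Next Obligation.
elim/cell3_ind=> t wt b /=; rewrite (src3E wt) (tgt3E wt) !(r3E _ wt) /id3 /int3.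
have w1 : wf (Th (Tid (sl (stgt (tsrc t)) b)) (Tr t (ssrc b))).
  by rewrite /= wt stgtr eqxx.
have w2 : wf (Th (Tr t (stgt b)) (Tid (sl (ssrc (tsrc t)) b))).
  by rewrite /= wt stgtl eqxx.
by rewrite !h3E // !v3E //; exact/mk3_eq/teq_int_natl.
Qed.

Lemma mnd_int_comp s' s (g f : lax_transf mnd_hom mnd_hom)
    (e : lt_tgt f = lt_src g) : stgt s = ssrc s' ->
  f = mnd_int s -> g = mnd_int s' -> mnd_int (scomp s' s) = lt_mul e.
Proof.
move=> E Ef Eg; subst f g.
apply: lax_transf_ext => /= [||k|b].
- by rewrite ssrc_comp.
- by rewrite stgt_comp.
- exact: sr_comp.
rewrite /id3 /int3.
have w1 : wf (Th (Tint s' b) (Tid (sr s (ssrc b)))).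
  by rewrite /= ssrc_comp ?stgtl ?stgtr // ssrcl E eqxx.
have w2 : wf (Th (Tid (sr s' (stgt b))) (Tint s b)).
  by rewrite /= stgt_comp ?stgtl ?stgtr // ssrcr E eqxx.
by rewrite !h3E // !v3E //; exact/mk3_eq/teq_int_compl.
Qed.

Program Definition mnd_comp : two_functor mnd_hom (lax_hom mnd_hom mnd_hom) :=
  @TwoFunctor mnd_hom (lax_hom mnd_hom mnd_hom) mnd_l mnd_int mnd_r
    _ _ _ _ _ _ _ _ _.
Next Obligation. by []. Qed.
Next Obligation. by []. Qed.
Next Obligation. by []. Qed.
Next Obligation. by []. Qed.
Next Obligation.
move=> n; apply: lax_transf_ext => //= [k|b]; first exact: sr_id.
exact/mk3_eq/teq_int_idl.
Qed.
Next Obligation.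
move=> s' s; rewrite -[tgt1 _]/(stgt s) -[src1 _]/(ssrc s') => E.
have e : lt_tgt (mnd_int s) = lt_src (mnd_int s') by rewrite /= E.
by rewrite [RHS](lt_comp1E e); exact: mnd_int_comp.
Qed.
Next Obligation.
move=> s; apply: modification_ext => /= [||n]; rewrite ?src3E ?tgt3E //.
by rewrite /id3 r3E //; exact/mk3_eq/teq_rid.
Qed.
Next Obligation.
elim/cell3_ind=> u wu; elim/cell3_ind=> t wt.
rewrite -[tgt2 _]/(tgt3 _) -[src2 _]/(src3 _) (tgt3E wt) (src3E wu) => E.
have w : wf (Tv u t) by rewrite /= wu wt E eqxx.
have e : md_tgt (mnd_r (mk3 t)) = md_src (mnd_r (mk3 u)).
  by rewrite /= (tgt3E wt) (src3E wu) E.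
rewrite [RHS](md_vcompE e) -[vcomp _ _]/(v3 (mk3 u) (mk3 t)) (v3E wu wt).
apply: modification_ext => /= [||n].
- by rewrite (src3E w) (src3E wt).
- by rewrite (tgt3E w) (tgt3E wu).
by rewrite (r3E _ w) (r3E _ wu) (r3E _ wt) v3E //; exact/mk3_eq/teq_rv.
Qed.
Next Obligation.
elim/cell3_ind=> u wu; elim/cell3_ind=> t wt.
rewrite -![src2 _]/(src3 _) (src3E wt) (src3E wu).
rewrite -[tgt1 _]/(stgt _) -[src1 _]/(ssrc _) => E.
have E' : stgt (ttgt t) = ssrc (ttgt u) by rewrite stgt_ttgt // ssrc_ttgt.
have w : wf (Th u t) by rewrite /= wu wt E eqxx.
have e : lt_tgt (md_src (mnd_r (mk3 t))) = lt_src (md_src (mnd_r (mk3 u))).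
  by rewrite /= (src3E wt) (src3E wu) E.
rewrite [RHS](md_hcompE e) -[hcomp _ _]/(h3 (mk3 u) (mk3 t)) (h3E wu wt).
apply: modification_ext => [||n].
- by rewrite [LHS]/= (src3E w); apply: mnd_int_comp; rewrite //= src3E.
- by rewrite [LHS]/= (tgt3E w); apply: mnd_int_comp; rewrite //= tgt3E.
by rewrite /= (r3E _ w) (r3E _ wu) (r3E _ wt) h3E //; exact/mk3_eq/teq_rh.
Qed.

Program Definition Mnd2 : laxgray_cat :=
  @LaxGrayCat (@LaxGrayData unit (fun _ _ => mnd_hom) (fun _ => 0)
    (fun _ _ _ => mnd_comp)) _ _ _ _ _ _ _ _ _ _ _ _ _ _ _ _.
Next Obligation. by []. Qed.
Next Obligation. by move=> ? ? s; exact: sl0. Qed.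
Next Obligation.
by move=> ? ?; elim/cell3_ind=> t wt; rewrite [LHS](l3E _ wt); exact/mk3_eq/teq_l0.
Qed.
Next Obligation. by move=> ? ? n; exact: addn0. Qed.
Next Obligation. by move=> ? ? s; exact: sr0. Qed.
Next Obligation.
by move=> ? ?; elim/cell3_ind=> t wt; rewrite [LHS](r3E _ wt); exact/mk3_eq/teq_r0.
Qed.
Next Obligation. by move=> *; exact: addnA. Qed.
Next Obligation. by move=> *; exact: slA. Qed.
Next Obligation. by move=> *; exact: slr. Qed.
Next Obligation. by move=> ? ? ? ? s k l; exact/esym/srA. Qed.
Next Obligation.
move=> ? ? ? ? k l; elim/cell3_ind=> t wt.
rewrite -[LHS]/(l3 k (l3 l _)) -[RHS]/(l3 (k + l) _).
by rewrite (l3E l wt) !l3E //; exact/mk3_eq/teq_ll.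
Qed.
Next Obligation.
move=> ? ? ? ? k; elim/cell3_ind=> t wt l.
rewrite -[LHS]/(l3 k (r3 _ l)) -[RHS]/(r3 (l3 k _) l).
by rewrite (r3E l wt) !(l3E k wt) r3E // l3E //; exact/mk3_eq/teq_lr.
Qed.
Next Obligation.
move=> ? ? ? ?; elim/cell3_ind=> t wt k l.
rewrite -[LHS]/(r3 _ (k + l)) -[RHS]/(r3 (r3 _ k) l).
by rewrite (r3E k wt) !r3E //; exact/esym/mk3_eq/teq_rr.
Qed.
Next Obligation.
move=> ? ? ? ? k s s'; rewrite -[LHS]/(l3 k (int3 s s')) /int3 l3E //.
exact/mk3_eq/teq_l_int.
Qed.
Next Obligation. by move=> ? ? ? ? s k s'; exact/mk3_eq/teq_m_int. Qed.
Next Obligation.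
move=> ? ? ? ? s s' k; rewrite -[RHS]/(r3 (int3 s s') k) /int3 r3E //.
exact/mk3_eq/teq_r_int.
Qed.

Definition Mnd2_star : obj Mnd2 := tt.

Definition Mnd2_tuple : @monad_data Mnd2 Mnd2_star :=
  @MonadData Mnd2 Mnd2_star 1 seta smu (mk3 Ta) (mk3 Tp) (mk3 Tq).

Fixpoint ev3 (t : term) : cell3 :=
  match t with
  | Ta => mk3 Ta
  | Tp => mk3 Tp
  | Tq => mk3 Tq
  | Tint a b => int3 a b
  | Tid s => id3 s
  | Tv u t => v3 (ev3 u) (ev3 t)
  | Th u t => h3 (ev3 u) (ev3 t)
  | Tl k t => l3 k (ev3 t)
  | Tr t k => r3 (ev3 t) k
  end.

Lemma ev3E t : wf t -> ev3 t = mk3 t.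
Proof.
elim: t => //=.
- by move=> u IHu t IHt /and3P[wu wt _]; rewrite IHu // IHt // v3E.
- by move=> u IHu t IHt /and3P[wu wt _]; rewrite IHu // IHt // h3E.
- by move=> k t IH wt; rewrite IH // l3E.
- by move=> t IH k wt; rewrite IH // r3E.
Qed.

Lemma ev3_eq t u : teq t u -> wf t -> ev3 t = ev3 u.
Proof.
move=> E wt; have [Ew _ _] := teq_inv E.
by rewrite !ev3E -?Ew //; exact: mk3_eq.
Qed.

Lemma Mnd2_laws : is_laxgray_monad (mT Mnd2_tuple) (meta Mnd2_tuple)
  (mmu Mnd2_tuple) (ma Mnd2_tuple) (mp Mnd2_tuple) (mq Mnd2_tuple).
Proof.
split=> //; try by rewrite /= ?src3E ?tgt3E.
- by apply: (ev3_eq teq_coh1); rewrite /=; cwf.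
- by apply: (ev3_eq teq_coh2); rewrite /=; cwf.
- by apply: (ev3_eq teq_coh3); rewrite /=; cwf.
- by apply: (ev3_eq teq_coh4); rewrite /=; cwf.
- by apply: (ev3_eq teq_coh5); rewrite /=; cwf.
Qed.

Definition Mnd2_monad : laxgray_monad Mnd2_star := LaxGrayMonad Mnd2_laws.

(* Main.v *)
From mathcomp Require Import all_boot.
From mathcomp Require Import boolp.
Require Import Defs.

Set Implicit Arguments.
Unset Strict Implicit.
Unset Printing Implicit Defensive.

Local Open Scope twocat_scope.
Local Open Scope laxgray_scope.

(** A lax-Gray monad [(T, eta, mu, a, p, q)] on [X] interprets every cell of
    [Mnd2] in [hom X X]: the 1-cell [n] as the power [T^n], a basic 2-cell as
    the corresponding whiskering of [eta] or [mu], a string as the composite of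
    its letters, and a term as the composite of 3-cells that it denotes.  The
    interpretation of terms respects the congruence [teq], since each of its
    generating equations is either a law of lax-Gray categories, valid in [C]
    (the laws of 2-categories, the functoriality of composition spelled out
    below for the six composites [compij], and the unit and associativity laws),
    or one of the five coherence equations, valid by hypothesis
    ([eval2_teq]).  It therefore descends to 3-cells and defines a lax-Gray
    functor [eval_functor] which sends the generating monad to the given one
    ([image_eval_functor]).

    Conversely, every cell of [Mnd2] is obtained from [T, eta, mu, a, p, q] by
    the lax-Gray operations.  Hence any lax-Gray functor [G] out of [Mnd2] is,
    by induction on powers, strings and terms, the interpretation of the
    six-tuple that is the image of the generating monad
    ([fun0_eval0], [fun1_eval1], [fun2_eval3]); so two lax-Gray functors with
    the same image of the generating monad are equal
    ([laxgray_functor_Mnd2_ext]). *)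

(** * Functoriality of composition on generating cells *)

Section CompositesTheory.
Variables (C : laxgray_data) (X Y Z : obj C).
Implicit Types (g : cell0 (hom Y Z)) (h : cell0 (hom X Y)).
Implicit Types (a : cell1 (hom Y Z)) (b : cell1 (hom X Y)).
Implicit Types (A : cell2 (hom Y Z)) (B : cell2 (hom X Y)).

Lemma src1_comp01 g b : src1 (g *01 b) = g *00 src1 b.
Proof. exact: fun_src1. Qed.
Lemma tgt1_comp01 g b : tgt1 (g *01 b) = g *00 tgt1 b.
Proof. exact: fun_tgt1. Qed.
Lemma comp01_id g h : g *01 id1 h = id1 (g *00 h).
Proof. exact: fun_id1. Qed.
Lemma comp01_comp1 g b' b : tgt1 b = src1 b' ->
  g *01 (b' *1 b) = (g *01 b') *1 (g *01 b).
Proof. exact: fun_comp1. Qed.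

Lemma src2_comp02 g B : src2 (g *02 B) = g *01 src2 B.
Proof. exact: fun_src2. Qed.
Lemma tgt2_comp02 g B : tgt2 (g *02 B) = g *01 tgt2 B.
Proof. exact: fun_tgt2. Qed.
Lemma comp02_id2 g b : g *02 id2 b = id2 (g *01 b).
Proof. exact: fun_id2. Qed.
Lemma comp02_vcomp g B' B : tgt2 B = src2 B' ->
  g *02 (B' *v B) = (g *02 B') *v (g *02 B).
Proof. exact: fun_vcomp. Qed.
Lemma comp02_hcomp g B' B : tgt1 (src2 B) = src1 (src2 B') ->
  g *02 (B' *h B) = (g *02 B') *h (g *02 B).
Proof. exact: fun_hcomp. Qed.

(** The next five lemmas express that composition, as a 2-functor into
    [P_L(hom X Y, hom X Z)], is compatible with sources, targets and 1-cell
    composites; evaluated at cells of [hom X Y] they give the laws of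
    [*10], [*20] and [*11] in the left argument. *)
Lemma lt_src_comp a : lt_src (fun1 (comp X Y Z) a) = comp X Y Z (src1 a).
Proof. exact: (fun_src1 (comp X Y Z)). Qed.
Lemma lt_tgt_comp a : lt_tgt (fun1 (comp X Y Z) a) = comp X Y Z (tgt1 a).
Proof. exact: (fun_tgt1 (comp X Y Z)). Qed.
Lemma md_src_comp A : md_src (fun2 (comp X Y Z) A) = fun1 (comp X Y Z) (src2 A).
Proof. exact: (fun_src2 (comp X Y Z)). Qed.
Lemma md_tgt_comp A : md_tgt (fun2 (comp X Y Z) A) = fun1 (comp X Y Z) (tgt2 A).
Proof. exact: (fun_tgt2 (comp X Y Z)). Qed.

Lemma fun1_comp_comp1 a' a (e : lt_tgt (fun1 (comp X Y Z) a) =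
    lt_src (fun1 (comp X Y Z) a')) : tgt1 a = src1 a' ->
  fun1 (comp X Y Z) (a' *1 a) = lt_mul e.
Proof. by move=> E; rewrite fun_comp1 // -(lt_comp1E e). Qed.

Lemma src1_comp10 a h : src1 (a *10 h) = src1 a *00 h.
Proof. by rewrite /comp10 lt_src0 lt_src_comp. Qed.
Lemma tgt1_comp10 a h : tgt1 (a *10 h) = tgt1 a *00 h.
Proof. by rewrite /comp10 lt_tgt0 lt_tgt_comp. Qed.
Lemma comp10_id g h : id1 g *10 h = id1 (g *00 h).
Proof. by rewrite /comp10 fun_id1. Qed.
Lemma comp10_comp1 a' a h : tgt1 a = src1 a' ->
  (a' *1 a) *10 h = (a' *10 h) *1 (a *10 h).
Proof.
move=> E; have e : lt_tgt (fun1 (comp X Y Z) a) = lt_src (fun1 (comp X Y Z) a').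
  by rewrite lt_tgt_comp lt_src_comp E.
by rewrite /comp10 (fun1_comp_comp1 e).
Qed.

Lemma src2_comp20 A h : src2 (A *20 h) = src2 A *10 h.
Proof. by rewrite /comp20 md_src0 md_src_comp. Qed.
Lemma tgt2_comp20 A h : tgt2 (A *20 h) = tgt2 A *10 h.
Proof. by rewrite /comp20 md_tgt0 md_tgt_comp. Qed.
Lemma comp20_id2 a h : id2 a *20 h = id2 (a *10 h).
Proof. by rewrite /comp20 fun_id2. Qed.
Lemma comp20_vcomp A' A h : tgt2 A = src2 A' ->
  (A' *v A) *20 h = (A' *20 h) *v (A *20 h).
Proof.
move=> E; have e : md_tgt (fun2 (comp X Y Z) A) = md_src (fun2 (comp X Y Z) A').
  by rewrite md_tgt_comp md_src_comp E.
by rewrite /comp20 fun_vcomp // [fun2 _ _ *v _](md_vcompE e).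
Qed.
Lemma comp20_hcomp A' A h : tgt1 (src2 A) = src1 (src2 A') ->
  (A' *h A) *20 h = (A' *20 h) *h (A *20 h).
Proof.
move=> E; have e : lt_tgt (md_src (fun2 (comp X Y Z) A)) =
    lt_src (md_src (fun2 (comp X Y Z) A')).
  by rewrite !md_src_comp lt_tgt_comp lt_src_comp E.
by rewrite /comp20 fun_hcomp // [fun2 _ _ *h _](md_hcompE e).
Qed.

Lemma src2_comp11 a b : src2 (a *11 b) = (a *10 tgt1 b) *1 (src1 a *01 b).
Proof. by rewrite /comp11 lt_src1 lt_src_comp. Qed.
Lemma tgt2_comp11 a b : tgt2 (a *11 b) = (tgt1 a *01 b) *1 (a *10 src1 b).
Proof. by rewrite /comp11 lt_tgt1 lt_tgt_comp. Qed.
Lemma comp11_idr a h : a *11 id1 h = id2 (a *10 h).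
Proof. exact: lt_id. Qed.
Lemma comp11_idl g b : id1 g *11 b = id2 (g *01 b).
Proof. by rewrite /comp11 fun_id1. Qed.
Lemma comp11_compr a b' b : tgt1 b = src1 b' ->
  a *11 (b' *1 b) =
  ((tgt1 a *01 b') *> (a *11 b)) *v ((a *11 b') <* (src1 a *01 b)).
Proof. by move=> E; rewrite /comp11 lt_comp // lt_tgt_comp lt_src_comp. Qed.
Lemma comp11_compl a' a b : tgt1 a = src1 a' ->
  (a' *1 a) *11 b =
  ((a' *11 b) <* (a *10 src1 b)) *v ((a' *10 tgt1 b) *> (a *11 b)).
Proof.
move=> E; have e : lt_tgt (fun1 (comp X Y Z) a) = lt_src (fun1 (comp X Y Z) a').
  by rewrite lt_tgt_comp lt_src_comp E.
by rewrite /comp11 (fun1_comp_comp1 e).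
Qed.
Lemma comp11_natr a B :
  ((tgt1 a *02 B) <* (a *10 src1 (src2 B))) *v (a *11 src2 B) =
  (a *11 tgt2 B) *v ((a *10 tgt1 (src2 B)) *> (src1 a *02 B)).
Proof.
by have := lt_nat (fun1 (comp X Y Z) a) B; rewrite lt_tgt_comp lt_src_comp.
Qed.
Lemma comp11_natl A b :
  ((tgt1 (src2 A) *01 b) *> (A *20 src1 b)) *v (src2 A *11 b) =
  (tgt2 A *11 b) *v ((A *20 tgt1 b) <* (src1 (src2 A) *01 b)).
Proof.
have := md_nat (fun2 (comp X Y Z) A) b.
by rewrite md_src_comp md_tgt_comp lt_tgt_comp lt_src_comp.
Qed.

End CompositesTheory.

(** * Interpretation of the cells of Mnd2 by a monad *)

Section Interpretation.
Variables (C : laxgray_cat) (X : obj C) (D : monad_data X).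

(** The power [T^n]. *)
Definition eval0 (n : nat) : cell0 (hom X X) := iter n (comp00 (mT D)) (one X).
Arguments eval0 : simpl never.

(** [T^i eta T^j] and [T^i mu T^j]. *)
Definition eval_basic (b : basic) : cell1 (hom X X) :=
  match b with
  | Beta i j => eval0 i *01 (meta D *10 eval0 j)
  | Bmu i j => eval0 i *01 (mmu D *10 eval0 j)
  end.

(** The composite of a word with source [T^n], whose head is applied first; [n]
    matters only when the word is empty. *)
Fixpoint eval_word (n : nat) (w : seq basic) : cell1 (hom X X) :=
  if w is b :: w' then eval_word (btgt b) w' *1 eval_basic b
  else id1 (eval0 n).

(** The 2-cell of the lax-Gray category denoted by a string. *)
Definition eval1 (s : string) := eval_word (ssrc s) (word s).
Arguments eval1 : simpl never.

(** The 3-cell denoted by a term; meaningful on well-formed terms only. *)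
Fixpoint eval2 (t : term) : cell2 (hom X X) :=
  match t with
  | Ta => ma D
  | Tp => mp D
  | Tq => mq D
  | Tint a b => eval1 a *11 eval1 b
  | Tid s => id2 (eval1 s)
  | Tv u t => eval2 u *v eval2 t
  | Th u t => eval2 u *h eval2 t
  | Tl k t => eval0 k *02 eval2 t
  | Tr t k => eval2 t *20 eval0 k
  end.

Lemma eval0S n : eval0 n.+1 = mT D *00 eval0 n. Proof. by []. Qed.

Lemma eval0_1 : eval0 1 = mT D. Proof. exact: unitr0. Qed.

Lemma eval0_add m n : eval0 (m + n) = eval0 m *00 eval0 n.
Proof.
elim: m => [|m IH]; first by rewrite unitl0.
by rewrite addSn !eval0S IH assoc000.
Qed.

Lemma eval0_2 : eval0 2 = mT D *00 mT D.
Proof. by rewrite (eval0_add 1 1) eval0_1. Qed.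

Lemma eval1_id n : eval1 (sid n) = id1 (eval0 n). Proof. by []. Qed.

Lemma eval1_cons b s : btgt b = ssrc s ->
  eval1 (scomp s (sbasic b)) = eval1 s *1 eval_basic b.
Proof. by move=> E; rewrite /eval1 word_comp //= E. Qed.

Lemma eval_basicl k b : eval_basic (basicl k b) = eval0 k *01 eval_basic b.
Proof. by case: b => i j; rewrite /= eval0_add assoc001. Qed.

Lemma eval_basicr k b : eval_basic (basicr b k) = eval_basic b *10 eval0 k.
Proof. by case: b => i j; rewrite /= eval0_add assoc100 assoc010. Qed.

(** The 3-cell denoted by a class of terms, computed on a representative; by
    [eval2_teq] the choice is immaterial when [D] is a monad. *)
Definition eval3 (x : cell3) : cell2 (hom X X) := eval2 (rep3 x).

(** The rest of the section uses that [D] satisfies the laws of a lax-Gray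
    monad. *)
Section Laws.
Variable L : is_laxgray_monad (mT D) (meta D) (mmu D) (ma D) (mp D) (mq D).

Lemma src1_basic b : src1 (eval_basic b) = eval0 (bsrc b).
Proof.
case: b => i j; rewrite /= src1_comp01 src1_comp10 eval0_add.
  by rewrite (src_eta L) unitl0.
by rewrite (src_mu L) -eval0_2 -eval0_add.
Qed.

Lemma tgt1_basic b : tgt1 (eval_basic b) = eval0 (btgt b).
Proof.
case: b => i j; rewrite /= tgt1_comp01 tgt1_comp10 eval0_add.
  by rewrite (tgt_eta L).
by rewrite (tgt_mu L).
Qed.

Lemma src1_word n w : chain n w -> src1 (eval_word n w) = eval0 n.
Proof.
elim: w n => [|b w IH] n /=; first by rewrite src1_id.
case/andP=> /eqP <- Hw.
by rewrite src1_comp ?src1_basic // IH // tgt1_basic.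
Qed.

Lemma tgt1_word n w : chain n w ->
  tgt1 (eval_word n w) = eval0 (foldl (fun _ => btgt) n w).
Proof.
elim: w n => [|b w IH] n /=; first by rewrite tgt1_id.
case/andP=> _ Hw.
by rewrite tgt1_comp ?IH // src1_word // tgt1_basic.
Qed.

Lemma src1_eval1 s : src1 (eval1 s) = eval0 (ssrc s).
Proof. exact/src1_word/(valP s). Qed.
Lemma tgt1_eval1 s : tgt1 (eval1 s) = eval0 (stgt s).
Proof. exact/tgt1_word/(valP s). Qed.

Lemma eval_word_cat n v w : chain n (v ++ w) ->
  eval_word n (v ++ w) =
  eval_word (foldl (fun _ => btgt) n v) w *1 eval_word n v.
Proof.
elim: v n => [|b v IH] n /=.
  by move=> Hw; rewrite -(src1_word Hw) comp1_idr.
case/andP=> _ Hvw; rewrite IH //.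
move: Hvw; rewrite chain_cat => /andP[Hv Hw].
by rewrite comp1A ?src1_word ?tgt1_word ?tgt1_basic.
Qed.

Lemma eval1_comp t s : stgt s = ssrc t ->
  eval1 (scomp t s) = eval1 t *1 eval1 s.
Proof.
move=> E; rewrite {1}/eval1 ssrc_comp // word_comp // eval_word_cat.
  by rewrite -/(stgt s) E.
by rewrite chain_cat (valP s) -/(stgt s) E (valP t).
Qed.

Lemma eval1_sl k s : eval1 (sl k s) = eval0 k *01 eval1 s.
Proof.
rewrite /eval1 ssrcl -[word (sl k s)]/(map (basicl k) (word s)).
have := valP s; rewrite -/(ssrc s) -/(word s).
elim: (word s) (ssrc s) => [|b w IH] n /=; first by rewrite comp01_id eval0_add.
case/andP=> _ Hw; rewrite comp01_comp1 ?src1_word ?tgt1_basic //.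
by rewrite basicl_tgt IH // eval_basicl.
Qed.

Lemma eval1_sr s k : eval1 (sr s k) = eval1 s *10 eval0 k.
Proof.
rewrite /eval1 ssrcr -[word (sr s k)]/(map (basicr^~ k) (word s)).
have := valP s; rewrite -/(ssrc s) -/(word s).
elim: (word s) (ssrc s) => [|b w IH] n /=; first by rewrite comp10_id eval0_add.
case/andP=> _ Hw; rewrite comp10_comp1 ?src1_word ?tgt1_basic //.
by rewrite basicr_tgt IH // eval_basicr.
Qed.

Lemma eval1_basic b : eval1 (sbasic b) = eval_basic b.
Proof. by rewrite /eval1 /= -tgt1_basic comp1_idl. Qed.

Lemma eval1_eta : eval1 seta = meta D.
Proof. by rewrite eval1_basic /= unitl1 unitr1. Qed.
Lemma eval1_mu : eval1 smu = mmu D.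
Proof. by rewrite eval1_basic /= unitl1 unitr1. Qed.

Definition eval_monadE :=
  (eval1_sl, eval1_sr, eval1_eta, eval1_mu, eval0_2, eval0_1).

Lemma src_tgt_eval2 t : wf t ->
  src2 (eval2 t) = eval1 (tsrc t) /\ tgt2 (eval2 t) = eval1 (ttgt t).
Proof.
elim: t => /=.
- by rewrite !eval1_comp // !eval_monadE (src_a L) (tgt_a L).
- by rewrite !eval1_comp // !eval_monadE (src_p L) (tgt_p L) eval1_id eval0_1.
- by rewrite !eval1_comp // !eval_monadE (src_q L) (tgt_q L) eval1_id eval0_1.
- move=> a b _; rewrite src2_comp11 tgt2_comp11 !src1_eval1 !tgt1_eval1.
  by rewrite !eval1_comp ?stgtl ?stgtr // !eval1_sl !eval1_sr.
- by move=> s _; rewrite src2_id tgt2_id.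
- move=> u IHu t IHt /and3P[/IHu[su tu] /IHt[st tt] /eqP E].
  by rewrite src2_vcomp ?tgt2_vcomp ?tt ?E.
- move=> u IHu t IHt /and3P[wu wt /eqP E].
  have [[su tu] [st tt]] := (IHu wu, IHt wt).
  rewrite src2_hcomp ?tgt2_hcomp su ?st ?src1_eval1 ?tgt1_eval1 ?E //.
  by rewrite tu tt !eval1_comp // stgt_ttgt // ssrc_ttgt.
- move=> k t IH /IH[st tt].
  by rewrite src2_comp02 tgt2_comp02 st tt !eval1_sl.
- move=> t IH k /IH[st tt].
  by rewrite src2_comp20 tgt2_comp20 st tt !eval1_sr.
Qed.

Lemma src2_eval2 t : wf t -> src2 (eval2 t) = eval1 (tsrc t).
Proof. by case/src_tgt_eval2. Qed.
Lemma tgt2_eval2 t : wf t -> tgt2 (eval2 t) = eval1 (ttgt t).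
Proof. by case/src_tgt_eval2. Qed.
Lemma src1_src2_eval2 t : wf t -> src1 (src2 (eval2 t)) = eval0 (ssrc (tsrc t)).
Proof. by move/src2_eval2->; exact: src1_eval1. Qed.
Lemma tgt1_src2_eval2 t : wf t -> tgt1 (src2 (eval2 t)) = eval0 (stgt (tsrc t)).
Proof. by move/src2_eval2->; exact: tgt1_eval1. Qed.

(** The interpretation satisfies the defining equations of [Mnd2].  Passing
    through [teq_trans] uses that well-formedness is invariant under [teq]. *)
Lemma eval2_teq t u : teq t u -> wf t -> eval2 t = eval2 u.
Proof.
elim=> {t u}.
- by [].
- by move=> t u E IH wu; rewrite IH //; case: (teq_inv E) => ->.
- by move=> t u v E IH _ IH' wt; rewrite IH // IH' //; case: (teq_inv E) => <-.
- by move=> t t' u u' _ IHt _ IHu /= /and3P[/IHu -> /IHt -> _].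
- by move=> t t' u u' _ IHt _ IHu /= /and3P[/IHu -> /IHt -> _].
- by move=> k t t' _ IH /= /IH ->.
- by move=> k t t' _ IH /= /IH ->.
- move=> v u t /= /and3P[wv /and3P[wu wt /eqP E] /eqP E'] _.
  by rewrite vcompA ?src2_eval2 ?tgt2_eval2 ?E ?E'.
- by move=> t wt _; rewrite /= -tgt2_eval2 // vcomp_idl.
- by move=> t wt _; rewrite /= -src2_eval2 // vcomp_idr.
- move=> v u t /= /and3P[wv /and3P[wu wt /eqP E] /eqP].
  rewrite stgt_comp // => E' _.
  by rewrite hcompA ?src1_src2_eval2 ?tgt1_src2_eval2 ?E ?E'.
- by move=> t wt _; rewrite /= eval1_id -tgt1_src2_eval2 // hcomp_idl.
- by move=> t wt _; rewrite /= eval1_id -src1_src2_eval2 // hcomp_idr.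
- move=> b a E _; rewrite /= hcomp_id2 ?src1_eval1 ?tgt1_eval1 ?E //.
  by rewrite eval1_comp.
- move=> u' u t' t /= /and3P[/and3P[wu' wu /eqP E] /and3P[wt' wt /eqP E']].
  move=> /eqP F _; rewrite hcomp_vcomp //.
  + by rewrite src2_eval2 // tgt2_eval2 // E'.
  + by rewrite src2_eval2 // tgt2_eval2 // E.
  + by rewrite src1_src2_eval2 // tgt1_src2_eval2 // F.
- by move=> k a _; rewrite /= comp02_id2 eval1_sl.
- move=> k u t /= /and3P[wu wt /eqP E] _.
  by rewrite comp02_vcomp // src2_eval2 // tgt2_eval2 // E.
- move=> k u t /= /and3P[wu wt /eqP E] _.
  by rewrite comp02_hcomp // src1_src2_eval2 // tgt1_src2_eval2 // E.
- by move=> k a _; rewrite /= comp20_id2 eval1_sr.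
- move=> k u t /= /and3P[wu wt /eqP E] _.
  by rewrite comp20_vcomp // src2_eval2 // tgt2_eval2 // E.
- move=> k u t /= /and3P[wu wt /eqP E] _.
  by rewrite comp20_hcomp // src1_src2_eval2 // tgt1_src2_eval2 // E.
- by move=> a n _; rewrite /= eval1_id comp11_idr eval1_sr.
- by move=> n b _; rewrite /= eval1_id comp11_idl eval1_sl.
- move=> a b' b E _; rewrite /= eval1_comp // comp11_compr.
    by rewrite !eval1_sl tgt1_eval1 src1_eval1.
  by rewrite tgt1_eval1 src1_eval1 E.
- move=> a' a b E _; rewrite /= eval1_comp // comp11_compl.
    by rewrite !eval1_sr tgt1_eval1 src1_eval1.
  by rewrite tgt1_eval1 src1_eval1 E.
- move=> a t wt _; rewrite /= !eval1_sr -src1_src2_eval2 // -tgt1_src2_eval2 //.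
  by rewrite -tgt1_eval1 -src1_eval1 -src2_eval2 // -tgt2_eval2 // comp11_natr.
- move=> t b wt _; rewrite /= !eval1_sl -src1_src2_eval2 // -tgt1_src2_eval2 //.
  by rewrite -tgt1_eval1 -src1_eval1 -src2_eval2 // -tgt2_eval2 // comp11_natl.
- by move=> t _; rewrite /= unitl2.
- by move=> t _; rewrite /= unitr2.
- by move=> k l t _; rewrite /= eval0_add assoc002.
- by move=> k l t _; rewrite /= eval0_add assoc200.
- by move=> k l t _; rewrite /= assoc020.
- by move=> k a b _; rewrite /= eval1_sl assoc011.
- by move=> a k b _; rewrite /= eval1_sl eval1_sr assoc101.
- by move=> a b k _; rewrite /= eval1_sr assoc110.
- by move=> _; rewrite [LHS]/= [RHS]/= !eval_monadE; exact: coh1 L.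
- by move=> _; rewrite [LHS]/= [RHS]/= !eval_monadE; exact: coh2 L.
- by move=> _; rewrite [LHS]/= [RHS]/= !eval_monadE; exact: coh3 L.
- by move=> _; rewrite [LHS]/= [RHS]/= !eval_monadE; exact: coh4 L.
- by move=> _; rewrite [LHS]/= [RHS]/= !eval_monadE; exact: coh5 L.
Qed.

Lemma eval3E t : wf t -> eval3 (mk3 t) = eval2 t.
Proof. by move=> wt; apply: eval2_teq; [exact: rep3_mk3 | exact: wf_rep3]. Qed.

#[local] Obligation Tactic := idtac.

(** The interpretation as a 2-functor between homs. *)
Program Definition eval_hom : two_functor mnd_hom (hom X X) :=
  @TwoFunctor mnd_hom (hom X X) eval0 eval1 eval3 _ _ _ _ _ _ _ _ _.
Next Obligation. exact: src1_eval1. Qed.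
Next Obligation. exact: tgt1_eval1. Qed.
Next Obligation. by move=> x; exact/src2_eval2/wf_rep3. Qed.
Next Obligation. by move=> x; exact/tgt2_eval2/wf_rep3. Qed.
Next Obligation. by []. Qed.
Next Obligation. by move=> t s; exact: eval1_comp. Qed.
Next Obligation. by move=> s; exact: (@eval3E (Tid s)). Qed.
Next Obligation.
by move=> y x /= E; apply: (@eval3E (Tv _ _)); rewrite /= !wf_rep3; exact/eqP.
Qed.
Next Obligation.
by move=> y x /= E; apply: (@eval3E (Th _ _)); rewrite /= !wf_rep3; exact/eqP.
Qed.

(** The lax-Gray functor that classifies the monad [D]. *)
Program Definition eval_functor : laxgray_functor Mnd2 C :=
  @LaxGrayFunctor Mnd2 C (fun _ => X) (fun _ _ => eval_hom) _ _ _ _ _ _ _.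
Next Obligation. by []. Qed.
Next Obligation. by move=> *; exact: eval0_add. Qed.
Next Obligation. by move=> *; exact: eval1_sl. Qed.
Next Obligation. by move=> ? ? ? k x; exact/(@eval3E (Tl k _))/wf_rep3. Qed.
Next Obligation. by move=> *; exact: eval1_sr. Qed.
Next Obligation. by move=> ? ? ? x k; exact/(@eval3E (Tr _ k))/wf_rep3. Qed.
Next Obligation. by move=> ? ? ? s s'; exact: (@eval3E (Tint s s')). Qed.

Lemma image_eval_functor : image_monad_data eval_functor Mnd2_monad = D.
Proof.
rewrite /image_monad_data /= !eval3E // eval0_1 eval1_eta eval1_mu /=.
by case: D.
Qed.

End Laws.
End Interpretation.

(** * Lax-Gray functors out of Mnd2 are determined by the image monad *)

(** Induction on a string, peeling off the letter that is applied first. *)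
Lemma string_cons_ind (P : string -> Prop) :
  (forall n, P (sid n)) ->
  (forall b s, btgt b = ssrc s -> P s -> P (scomp s (sbasic b))) ->
  forall s, P s.
Proof.
move=> Pid Pcons [[n w] /= H]; elim: w n H => [|b w IH] n H.
  by have -> : exist _ (n, [::]) H = sid n by exact: string_ext.
have /andP[/eqP En Hw] := H.
pose s : string := exist (fun s => is_true (chain s.1 s.2)) (btgt b, w) Hw.
suff -> : exist _ (n, b :: w) H = scomp s (sbasic b).
  by apply: Pcons; last exact: IH.
by apply: string_ext; rewrite ?ssrc_comp ?word_comp.
Qed.

(** Basic 2-cells are whiskerings of [eta] and [mu] by powers of [T]. *)
Lemma sbasicE b : sbasic b =
  match b with Beta i j => sl i (sr seta j) | Bmu i j => sl i (sr smu j) end.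
Proof.
by case: b => i j; apply: string_ext; rewrite /ssrc /word /= ?addn0 //= ?addnA.
Qed.

(** A lax-Gray functor [G] out of [Mnd2] is the interpretation of the six-tuple
    [D], the image under [G] of the generating monad. *)
Section Determination.
Variables (C : laxgray_cat) (G : laxgray_functor Mnd2 C).
Let D := image_monad_data G Mnd2_monad.
Let H : two_functor mnd_hom (hom (G tt) (G tt)) := lg_hom G tt tt.

Lemma fun0_eval0 n : H n = eval0 D n.
Proof.
elim: n => [|n IH]; first exact: (lg_one G tt).
by rewrite eval0S -IH; exact: (@lg_comp00 _ _ G tt tt tt 1 n).
Qed.

Lemma fun1_sl k s : fun1 H (sl k s) = H k *01 fun1 H s.
Proof. exact: (@lg_comp01 _ _ G tt tt tt). Qed.
Lemma fun1_sr s k : fun1 H (sr s k) = fun1 H s *10 H k.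
Proof. exact: (@lg_comp10 _ _ G tt tt tt). Qed.

Lemma fun1_eval1 s : fun1 H s = eval1 D s.
Proof.
elim/string_cons_ind: s => [n|b s E IH].
  by rewrite (fun_id1 H n : fun1 H (sid n) = _) fun0_eval0.
have -> : fun1 H (scomp s (sbasic b)) = fun1 H s *1 fun1 H (sbasic b).
  exact: (fun_comp1 H).
rewrite IH eval1_cons // sbasicE; congr comp1.
by case: b {E} => i j; rewrite fun1_sl fun1_sr !fun0_eval0.
Qed.

Lemma fun2_eval2 t : wf t -> fun2 H (mk3 t) = eval2 D t.
Proof.
elim: t => [|||a b|s|u IHu t IHt|u IHu t IHt|k t IH|t IH k] //.
- move=> _; rewrite [RHS]/= -!fun1_eval1.
  exact: (@lg_comp11 _ _ G tt tt tt).
- move=> _; rewrite [RHS]/= -fun1_eval1; exact: (fun_id2 H).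
- case/and3P=> wu wt /eqP E; rewrite [RHS]/= -IHu // -IHt // -v3E //.
  by apply: (fun_vcomp H); rewrite /= src3E ?tgt3E.
- case/and3P=> wu wt /eqP E; rewrite [RHS]/= -IHu // -IHt // -h3E //.
  by apply: (fun_hcomp H); rewrite /= !src3E.
- move=> wt; rewrite [RHS]/= -IH // -fun0_eval0 -l3E //.
  exact: (@lg_comp02 _ _ G tt tt tt).
- move=> wt; rewrite [RHS]/= -IH // -fun0_eval0 -r3E //.
  exact: (@lg_comp20 _ _ G tt tt tt).
Qed.

Lemma fun2_eval3 x : fun2 H x = eval3 D x.
Proof. by rewrite -{1}[x]rep3K fun2_eval2 // wf_rep3. Qed.

End Determination.

Lemma laxgray_functor_Mnd2_ext (C : laxgray_cat)
    (F G : laxgray_functor Mnd2 C) :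
  existT (@monad_data C) (F Mnd2_star) (image_monad_data F Mnd2_monad) =
  existT (@monad_data C) (G Mnd2_star) (image_monad_data G Mnd2_monad) ->
  F = G.
Proof.
case: F => f fH f1 f2 f3 f4 f5 f6 f7; case: G => g gH g1 g2 g3 g4 g5 g6 g7.
set F := LaxGrayFunctor f1 _ _ _ _ _ _; set G := LaxGrayFunctor g1 _ _ _ _ _ _.
move=> E; have efg : f = g by apply/funext => -[]; exact: projT1_eq E.
subst g.
have {}E : image_monad_data F Mnd2_monad = image_monad_data G Mnd2_monad.
  (* Both functors now send the object to [f tt], and the transport along the
     equality of first components is trivial by proof irrelevance. *)
  by have := projT2_eq E; rewrite (Prop_irrelevance (projT1_eq E) erefl).
have eH : fH = gH.
  apply: functional_extensionality_dep => -[].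
  apply: functional_extensionality_dep => -[].
  apply: two_functor_ext => x.
  - by rewrite (fun0_eval0 F) (fun0_eval0 G) E.
  - by rewrite (fun1_eval1 F) (fun1_eval1 G) E.
  - by rewrite (fun2_eval3 F) (fun2_eval3 G) E.
rewrite /F /G; clear F G E; subst gH.
by congr LaxGrayFunctor; apply: Prop_irrelevance.
Qed.

Theorem theorem5p2 (C : laxgray_cat) (X : obj C) (M : laxgray_monad X) :
  exists! G : laxgray_functor Mnd2 C,
    existT (@monad_data C) (G Mnd2_star) (image_monad_data G Mnd2_monad) =
    existT (@monad_data C) X M.
Proof.
have EM : existT (@monad_data C) X (image_monad_data (eval_functor (m_laws M))
    Mnd2_monad) = existT (@monad_data C) X M by rewrite image_eval_functor.
exists (eval_functor (m_laws M)); split=> [|G EG]; first exact: EM.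
by apply: laxgray_functor_Mnd2_ext; rewrite EG; exact: EM.
Qed.
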